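(* For any theory $T$ the following are equivalent: (1) $T$ is dp-minimal. (2) For every $n\ge 1$: if $(\bar a_i)_{i\in I}$ is an indiscernible sequence and $\bar c$ is an $n$-tuple, then there is a partition of $I$ into finitely many convex sets $I_1,\dots,I_m$, at most $2^n$ of which are infinite, so that if $1\le l\le m$ and $i,j\in I_l$ then $\mathrm{tp}(\bar a_i/\bar c)=\mathrm{tp}(\bar a_j/\bar c)$. (3) For every $n\ge 1$: if $(\bar a_i)_{i\in I}$ is an indiscernible sequence and $\bar c$ is an $n$-tuple, then there is a partition of $I$ into finitely many convex sets $I_1,\dots,I_m$, at most $2^n$ of which are infinite, so that for every $1\le l\le m$ the sequence $(\bar a_i)_{i\in I_l}$ is indiscernible over $\bar c$. (4) For every $n\ge 1$: there is no sequence of formulae $\phi_1(\bar x,\bar y),\dots,\phi_{2^n}(\bar x,\bar y)$ with $|\bar x|=n$ and sequences $(\bar a^j_i)_{i\in\omega}$, $1\le j\le 2^n$, such that for every $\eta:\{1,\dots,2^n\}\to\omega$ the type $$\bigwedge_{1\le k\le 2^n}\phi_k(\bar x,\bar a^k_{\eta(k)})\wedge\bigwedge_{1\le k\le 2^n}\ \bigwedge_{t\in\omega,\,t\ne\eta(k)}\neg\phi_k(\bar x,\bar a^k_t)$$ is consistent.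
   Context: $T$ is a complete theory; tuples and sequences are taken in a monster model of $T$. $I$ ranges over arbitrary linear orders, and indiscernible sequences are sequences of finite tuples of a fixed length. An ICT pattern in a structure $M$ consists of formulae $\phi(x,\bar y)$, $\psi(x,\bar y)$, with $x$ a single variable and $\bar y$ a finite tuple of variables, and sequences $(\bar a_i)_{i\in\omega}$, $(\bar b_i)_{i\in\omega}$ of tuples from $M$ such that for all $i,j\in\omega$ the set $\{\phi(x,\bar a_i),\psi(x,\bar b_j)\}\cup\{\neg\phi(x,\bar a_l):l\neq i\}\cup\{\neg\psi(x,\bar b_k):k\neq j\}$ is consistent (realized in some elementary extension of $M$). A theory is dp-minimal if there is no ICT pattern in any of its models. *)

(* Defs.v *)
From mathcomp Require Import all_boot all_order.
From mathcomp Require Import boolp classical_sets functions cardinality.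

Set Implicit Arguments.
Unset Strict Implicit.
Unset Printing Implicit Defensive.

Local Open Scope classical_set_scope.
Local Open Scope card_scope.

(* One-sorted first-order languages; constants are the function symbols of
   arity 0. *)
Record language := Language {
  func : Type;
  farity : func -> nat;
  rel_symb : Type;
  rarity : rel_symb -> nat }.

Inductive term (L : language) (V : Type) : Type :=
| Var of V
| App (f : func L) of ('I_(farity f) -> term L V).

(* [formula L V]: first-order L-formulas (with equality) whose free variables
   are among the elements of V.  The quantifier binds the extra variable [None]
   of [option V].  Tuples of variables or of elements are families, so
   phi(x, y) with |x| = n and |y| = k has type [formula L ('I_n + 'I_k)]. *)
Inductive formula (L : language) (V : Type) : Type :=
| Bot
| Equ of term L V & term L V
| Rel (r : rel_symb L) of ('I_(rarity r) -> term L V)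
| Imp of formula L V & formula L V
| All of formula L (option V).

Arguments Bot {L V}.

Definition Neg L V (phi : formula L V) : formula L V := Imp phi Bot.

Fixpoint tsubst L V W (g : V -> W) (t : term L V) : term L W :=
  match t with
  | Var v => Var L (g v)
  | App f ts => App (fun i => tsubst g (ts i))
  end.

Fixpoint rename L V W (g : V -> W) (phi : formula L V) : formula L W :=
  match phi with
  | Bot => Bot
  | Equ t u => Equ (tsubst g t) (tsubst g u)
  | Rel r ts => Rel (fun i => tsubst g (ts i))
  | Imp p q => Imp (rename g p) (rename g q)
  | All p => All (rename (omap g) p)
  end.

Record structure (L : language) := Structure {
  carrier :> Type;
  carrier_inhabited : inhabited carrier;
  finterp : forall f : func L, ('I_(farity f) -> carrier) -> carrier;
  rinterp : forall r : rel_symb L, ('I_(rarity r) -> carrier) -> Prop }.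

Fixpoint teval L (M : structure L) V (v : V -> M) (t : term L V) : M :=
  match t with
  | Var x => v x
  | App f ts => finterp (fun i => teval v (ts i))
  end.

Fixpoint sat L (M : structure L) V (v : V -> M) (phi : formula L V) : Prop :=
  match phi with
  | Bot => False
  | Equ t u => teval v t = teval v u
  | Rel r ts => rinterp (fun i => teval v (ts i))
  | Imp p q => sat v p -> sat v q
  | All p => forall x : M, sat (fun o => if o is Some y then v y else x) p
  end.

Definition sentence L := formula L void.
Definition theory L := set (sentence L).

Definition model L (T : theory L) (M : structure L) : Prop :=
  forall phi, T phi -> sat (of_void M) phi.

Definition entails L (T : theory L) (phi : sentence L) : Prop :=
  forall M : structure L, model T M -> sat (of_void M) phi.

Definition complete L (T : theory L) : Prop :=
  (exists M : structure L, model T M) /\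
  (forall phi, entails T phi \/ entails T (Neg phi)).

(* An elementary extension of M is a structure N together with an elementary
   map M -> N. *)
Definition elementary L (M N : structure L) (f : M -> N) : Prop :=
  forall n (phi : formula L 'I_n) (v : 'I_n -> M), sat v phi <-> sat (f \o v) phi.

Definition join V W M (x : V -> M) (y : W -> M) (s : V + W) : M :=
  match s with inl i => x i | inr j => y j end.

(* Formulas in the variables X with parameters in M are elements of
   [formula L (X + M)]; [inst phi a] is phi(x, a). *)
Definition inst L (M : structure L) X Y (phi : formula L (X + Y)) (a : Y -> M) :
    formula L (X + M) :=
  rename (fun s => match s with inl x => inl x | inr y => inr (a y) end) phi.

Definition consistent L (M : structure L) X (p : set (formula L (X + M))) : Prop :=
  exists (N : structure L) (f : M -> N),
    elementary f /\ exists x : X -> N, forall phi, p phi -> sat (join x f) phi.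

Definition ICT_pattern L (M : structure L) k (phi psi : formula L (unit + 'I_k))
    (a b : nat -> 'I_k -> M) : Prop :=
  forall i j : nat,
    consistent ([set inst phi (a i); inst psi (b j)]
      `|` [set Neg (inst phi (a l)) | l in [set l | l <> i]]
      `|` [set Neg (inst psi (b l)) | l in [set l | l <> j]]).

Definition dp_minimal L (T : theory L) : Prop :=
  forall M : structure L, model T M ->
    ~ exists k (phi psi : formula L (unit + 'I_k)) (a b : nat -> 'I_k -> M),
        ICT_pattern phi psi a b.

(* tp(a/c); its elements are the formulas phi(x, z) such that phi(a, c) holds. *)
Definition tp L (M : structure L) V W (a : V -> M) (c : W -> M) :
    set (formula L (V + W)) :=
  [set phi | sat (join a c) phi].

(* The subsequence (a_i)_{i in D} is indiscernible over the tuple c. *)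
Definition indiscernible_over L (M : structure L) d (I : orderType d) k W
    (D : set I) (a : I -> 'I_k -> M) (c : W -> M) : Prop :=
  forall m (s t : 'I_m -> I),
    (forall u, D (s u)) -> (forall u, D (t u)) ->
    (forall u v : 'I_m, (u < v)%N -> (s u < s v)%O) ->
    (forall u v : 'I_m, (u < v)%N -> (t u < t v)%O) ->
    tp (fun p : 'I_m * 'I_k => a (s p.1) p.2) c =
    tp (fun p : 'I_m * 'I_k => a (t p.1) p.2) c.

Definition indiscernible L (M : structure L) d (I : orderType d) k
    (a : I -> 'I_k -> M) : Prop :=
  indiscernible_over setT a (of_void M).

Definition convex d (I : orderType d) (D : set I) : Prop :=
  forall i j l : I, D i -> D l -> (i <= j <= l)%O -> D j.

(* A partition of I into finitely many convex (nonempty) sets P_0, ..., P_(m-1),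
   at most N of which are infinite. *)
Definition convex_partition d (I : orderType d) (N m : nat) (P : 'I_m -> set I) :
    Prop :=
  [/\ partition [set: 'I_m] P [set: I],
      forall l, convex (P l) &
      (#|[pred l : 'I_m | `[< infinite_set (P l) >]]| <= N)%N].

(* kappa is the cardinality of the type K. *)
Definition small (K : Type) T (A : set T) : Prop := ~ ([set: K] #<= A).

Definition finitely_satisfiable L (M : structure L) X W (c : W -> M)
    (p : set (formula L (X + W))) : Prop :=
  forall q, q `<=` p -> finite_set q ->
    exists x : X -> M, forall phi, q phi -> sat (join x c) phi.

Definition saturated (K : Type) L (M : structure L) : Prop :=
  forall (A : set M), small K A ->
  forall p : set (formula L (unit + set_type A)),
    let par := fun y : set_type A => val y in
    finitely_satisfiable par p ->
    exists x : unit -> M, forall phi, p phi -> sat (join x par) phi.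

Definition automorphism L (M : structure L) (g : M -> M) : Prop :=
  [/\ bijective g,
      forall (f : func L) (v : 'I_(farity f) -> M),
        g (finterp v) = finterp (g \o v) &
      forall (r : rel_symb L) (v : 'I_(rarity r) -> M),
        rinterp v <-> rinterp (g \o v)].

(* Only the values of h on A matter: h represents a partial map with domain A. *)
Definition partial_elementary L (M : structure L) (A : set M) (h : M -> M) : Prop :=
  forall n (phi : formula L 'I_n) (v : 'I_n -> M),
    (forall i, A (v i)) -> (sat v phi <-> sat (h \o v) phi).

Definition strongly_homogeneous (K : Type) L (M : structure L) : Prop :=
  forall (A : set M) (h : M -> M), small K A -> partial_elementary A h ->
    exists2 g : M -> M, automorphism g & forall x, A x -> g x = h x.

(* A monster model of T: kappa-saturated and strongly kappa-homogeneous for some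
   kappa > |L| + aleph_0, the number of L-formulas in countably many variables. *)
Definition monster L (T : theory L) (M : structure L) : Prop :=
  model T M /\
  exists K : Type, [/\ small K [set: formula L nat], saturated K M &
                       strongly_homogeneous K M].

(* Main.v *)
Require Import Defs.
From mathcomp Require Import all_boot all_order zify.
From mathcomp Require Import boolp classical_sets functions cardinality filter.

Set Implicit Arguments.
Unset Strict Implicit.
Unset Printing Implicit Defensive.

Import Order.TTheory.

Local Open Scope classical_set_scope.
Local Open Scope card_scope.

(** Write (1)-(4) for the four conditions in the order of the theorem.  The
    implications proved are (1) -> (3) -> (2) -> (4) -> (1); for the second
    one, indiscernibility of a piece over c gives constant types over c.

    (1) -> (3).  Elements are added to the base one at a time, and each new
    element cuts an infinite piece D into at most two infinite pieces and one
    point ([one_element_pieces]).  Indeed let [Lo] be the set of i in D such that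
    the sequence up to i stays indiscernible over the new element y, and [Hi] the
    set of i such that the sequence from i on does.  Both are pieces on which the
    sequence is indiscernible over y.  If two points i0 < j0 of D were outside of
    both, the sequence would fail to be indiscernible over y below i0, through a
    formula theta1, and above j0, through a formula theta2.  By indiscernibility
    over the old base, these two failures can be placed anywhere in D, with as
    much room around them as needed; counting the values of theta1 and theta2 on
    blocks in that room ([row_selection]) gives sequences of blocks in which theta1
    changes inside one prescribed pair of consecutive blocks and inside no other
    pair, and independently for theta2.  So the exclusive disjunctions of theta1, and of theta2, at two
    consecutive blocks form finite patterns of every size, and by compactness an
    ICT pattern.

    (2) -> (4).  From a pattern with 2 ^ n rows in n variables, concatenating the
    rows and taking the limit along the powers of an ultrafilter gives an
    indiscernible sequence indexed by nat x nat, ordered lexicographically, and a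
    tuple x that singles out the index (r + 1, 0) in row r
    ([indiscernible_pattern]).  No piece with constant type over x contains one of
    these 2 ^ n indices and another index, so the 2 ^ n + 1 infinite intervals that
    they delimit need pairwise different infinite pieces
    ([constant_types_no_long_pattern]).

    (4) -> (1).  An ICT pattern in some model of T has its finite parts described
    by sentences; T is complete, so they occur in M, and compactness yields a
    pattern with 2 = 2 ^ 1 rows in one variable ([no_long_pattern_dp_minimal]).

    Compactness is [realize]: M realizes every type in countably many variables
    that is approximately realized in M, one variable after the other. *)

(** * Formulas and their finite support *)

Section Syntax.
Variable L : language.
Implicit Types (V W : Type).

Lemma join_inl V W (M : Type) (x : V -> M) (y : W -> M) : join x y \o inl = x.
Proof. by []. Qed.

Lemma teval_subst (M : structure L) V W (g : V -> W) (v : W -> M) t :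
  teval v (tsubst g t) = teval (v \o g) t.
Proof.
elim: t => //= f ts IH; congr finterp; apply/funext => i; exact: IH.
Qed.

Lemma sat_rename (M : structure L) V W (g : V -> W) (v : W -> M) phi :
  sat v (rename g phi) <-> sat (v \o g) phi.
Proof.
elim: phi W g v =>
  [V0 W g v|V0 t u W g v|V0 r ts W g v|V0 p IHp q IHq W g v|V0 p IH W g v] //=.
- by rewrite !teval_subst.
- by rewrite (_ : (fun i => _) = (fun i => teval (v \o g) (ts i)))//;
    apply/funext => i; rewrite teval_subst.
- by rewrite IHp IHq.
- by split=> h x; have := h x; rewrite IH;
    rewrite (_ : _ \o _ = fun o => if o is Some y then v (g y) else x)//;
    apply/funext => -[].
Qed.

Fixpoint tocc V (t : term L V) : set V :=
  match t with
  | Var x => [set x]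
  | App f ts => \bigcup_(i in [set: 'I_(farity f)]) tocc (ts i)
  end.

(** The free variables; [Some @^-1`] discards the variable bound by the
    quantifier. *)
Fixpoint occ V (phi : formula L V) : set V :=
  match phi with
  | Bot => set0
  | Equ t u => tocc t `|` tocc u
  | Rel r ts => \bigcup_(i in [set: 'I_(rarity r)]) tocc (ts i)
  | Imp p q => occ p `|` occ q
  | All p => Some @^-1` occ p
  end.

Lemma finite_tocc V (t : term L V) : finite_set (tocc t).
Proof. by elim: t => //= f ts IH; apply: bigcup_finite. Qed.

Lemma finite_occ V (phi : formula L V) : finite_set (occ phi).
Proof.
elim: phi => //= {V} V.
- by move=> t u; rewrite finite_setU; split; apply: finite_tocc.
- by move=> r ts; apply: bigcup_finite => // i _; apply: finite_tocc.
- by move=> p Hp q Hq; rewrite finite_setU.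
- by move=> p Hp; apply: finite_preimage => // x y _ _ [].
Qed.

Lemma teval_ext (M : structure L) V (v w : V -> M) t :
  (forall x, tocc t x -> v x = w x) -> teval v t = teval w t.
Proof.
elim: t => [x h|f ts IH h] /=; first exact: h.
by congr finterp; apply/funext => i; apply: IH => x hx; apply: h; exists i.
Qed.

Lemma sat_ext (M : structure L) V (v w : V -> M) phi :
  (forall x, occ phi x -> v x = w x) -> sat v phi <-> sat w phi.
Proof.
elim: phi v w =>
  [V0 v w|V0 t u v w h|V0 r ts v w h|V0 p IHp q IHq v w h|V0 p IH v w h] //=.
- by rewrite (@teval_ext _ _ v w t) ?(@teval_ext _ _ v w u)// => x hx; apply: h;
    [right|left].
- rewrite (_ : (fun i => _) = (fun i => teval w (ts i)))//.
  by apply/funext => i; apply: teval_ext => x hx; apply: h; exists i.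
- by rewrite (IHp v w) ?(IHq v w)// => x hx; apply: h; [right|left].
- split=> H x; have := H x; rewrite (IH _ (fun o => if o is Some y then w y else x))//;
  by case=> // y hy; apply: h.
Qed.

Lemma sat_Neg (M : structure L) V (v : V -> M) phi : sat v (Neg phi) <-> ~ sat v phi.
Proof. by []. Qed.

Definition Ex V (phi : formula L (option V)) : formula L V := Neg (All (Neg phi)).

Lemma sat_Ex (M : structure L) V (v : V -> M) phi :
  sat v (Ex phi) <-> exists x : M, sat (fun o => if o is Some y then v y else x) phi.
Proof.
split=> [/= h|[x hx] /= h]; last exact: h hx.
by apply: contrapT => hn; apply: h => x hx; apply: hn; exists x.
Qed.

Definition Xor V (p q : formula L V) : formula L V := Imp (Imp p q) (Neg (Imp q p)).

Lemma sat_Xor (M : structure L) V (v : V -> M) p q :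
  sat v (Xor p q) <-> ~ (sat v p <-> sat v q).
Proof.
by rewrite /=; have [hp|hp] := pselect (sat v p); have [hq|hq] := pselect (sat v q); tauto.
Qed.

Definition Lit V (b : bool) (p : formula L V) := if b then p else Neg p.

Lemma sat_Lit (M : structure L) V (v : V -> M) b p :
  sat v (Lit b p) <-> (sat v p <-> b).
Proof.
case: b => /=; first by split=> [h|h]; [split|exact: h.2].
by split=> [h|h /h].
Qed.

Definition Conj V (s : seq (formula L V)) : formula L V :=
  foldr (fun p q => Neg (Imp p (Neg q))) (Neg Bot) s.

Lemma sat_Conj_cons (M : structure L) V (v : V -> M) p s :
  sat v (Conj (p :: s)) <-> sat v p /\ sat v (Conj s).
Proof.
rewrite /=; have [hp|hp] := pselect (sat v p);
by have [hq|hq] := pselect (sat v (Conj s)); rewrite /Conj in hq *; tauto.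
Qed.

Lemma sat_Conj (M : structure L) V (v : V -> M) (X : finType) (f : X -> formula L V) :
  sat v (Conj [seq f x | x <- enum X]) <-> forall x, sat v (f x).
Proof.
have H s : sat v (Conj [seq f x | x <- s]) <-> forall x, x \in s -> sat v (f x).
  elim: s => [|x s IH]; first by split=> [_ x|_ []].
  rewrite map_cons sat_Conj_cons IH; split=> [[h1 h2] y|h].
    by rewrite inE => /predU1P[->//|]; apply: h2.
  by split=> [|y hy]; apply: h; rewrite inE ?eqxx// hy orbT.
by rewrite H; split=> h x // ; apply: h; rewrite mem_enum.
Qed.

(** The tuple x is quantified one variable at a time.  The formula psi depends on
    phi alone, so that it can be compared in different structures. *)
Lemma ex_closure (X : finType) V (phi : formula L (X + V)) :
  exists psi : formula L V, forall (M : structure L) (v : V -> M),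
    sat v psi <-> exists x : X -> M, sat (join x v) phi.
Proof.
have ord_case n V' (chi : formula L ('I_n + V')) :
  exists psi : formula L V', forall (M : structure L) (v : V' -> M),
    sat v psi <-> exists x : 'I_n -> M, sat (join x v) chi.
  elim: n chi => [|n IH] chi.
    pose g (s : 'I_0 + V') : V' :=
      match s with inl i => False_rect _ (notF (ltn_ord i)) | inr y => y end.
    exists (rename g chi) => M v; rewrite sat_rename.
    have E (x : 'I_0 -> M) : join x v = v \o g by apply/funext => -[[]|].
    split=> [h|[x]]; last by rewrite E.
    by exists (v \o g \o inl); rewrite E.
  pose g (s : 'I_n.+1 + V') : option ('I_n + V') :=
    match s with
    | inl i => omap inl (unlift ord_max i)
    | inr y => Some (inr y) end.
  have [psi Hpsi] := IH (Ex (rename g chi)).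
  exists psi => M v; rewrite Hpsi; split.
    move=> [x /sat_Ex[y]]; rewrite sat_rename => h.
    exists (fun i => if unlift ord_max i is Some j then x j else y).
    rewrite (_ : join _ _ = (fun o => if o is Some s then join x v s else y) \o g)//.
    by apply/funext => -[i|y']//=; case: (unlift _ _).
  move=> [x h]; exists (fun j => x (lift ord_max j)); apply/sat_Ex.
  exists (x ord_max); rewrite sat_rename.
  rewrite (_ : _ \o g = join x v)//.
  by apply/funext => -[i|y']//=; case: unliftP => [j ->|->].
have [psi Hpsi] := ord_case _ _ (rename (fun s : X + V =>
  match s with inl x => inl (enum_rank x) | inr y => inr y end) phi).
exists psi => M v; rewrite Hpsi; split=> -[x h].
  exists (x \o enum_rank); move: h; rewrite sat_rename.
  by rewrite (_ : _ \o _ = join (x \o enum_rank) v)//; apply/funext => -[].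
exists (x \o enum_val); rewrite sat_rename.
rewrite (_ : _ \o _ = join x v)//.
by apply/funext => -[i|]//=; rewrite enum_rankK.
Qed.

(** The codomain is inhabited, so that e is a total function even if V is
    infinite and A empty. *)
Lemma finite_code V (A : set V) : finite_set A ->
  exists n (e : V -> 'I_n.+1), {in A &, injective e}.
Proof.
move=> [n]; rewrite card_eq_le => /andP[/pcard_leP[f] _].
exists n, (fun x => inord (f x)) => x y Ax Ay /(congr1 val) /=.
have fn z : z \in A -> (f z < n.+1)%N.
  rewrite inE => Az; have := @funS _ _ _ _ f z Az.
  by rewrite /= => /ltnW; rewrite ltnS.
rewrite !inordK ?fn// => exy.
by apply: (@inj _ _ _ f).
Qed.

(** Q is closed under conjunction, in the form in which [Conj] writes it. *)
Lemma finite_conj V (Q : set (formula L V)) (q : set (formula L V)) :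
  Q (Neg Bot) -> (forall p1 p2, Q p1 -> Q p2 -> Q (Neg (Imp p1 (Neg p2)))) ->
  q `<=` Q -> finite_set q ->
  exists2 Phi, Q Phi & forall (M : structure L) (v : V -> M),
    sat v Phi -> forall phi, q phi -> sat v phi.
Proof.
move=> QT QC qQ /finite_code[n [e einj]].
have /choice[f Hf] (i : 'I_n.+1) : exists phi, Q phi /\
    forall psi, q psi -> e psi = i -> psi = phi.
  have [[phi [qphi ephi]]|H] := pselect (exists phi, q phi /\ e phi = i).
    exists phi; split=> [|psi qpsi epsi]; first exact: qQ.
    by apply: einj; rewrite ?inE// epsi ephi.
  by exists (Neg Bot); split=> // psi qpsi epsi; case: H; exists psi.
exists (Conj [seq f i | i <- enum 'I_n.+1]).
  elim: (enum _) => //= i s IH; apply: QC => //; exact: (Hf i).1.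
move=> M v /sat_Conj h phi qphi.
by rewrite ((Hf (e phi)).2 _ qphi erefl); apply: h.
Qed.

End Syntax.

(** * Realizing countable types in a saturated structure *)

Section Elementary.
Variable L : language.

(** Elementary maps are defined through formulas in finitely many variables; by
    finite support they respect formulas in any variables. *)
Lemma elementary_sat (M N : structure L) (f : M -> N) V (v : V -> M) phi :
  elementary f -> sat v phi <-> sat (f \o v) phi.
Proof.
move=> fE; have [n [e einj]] := finite_code (finite_occ phi).
have /choice[w Hw] (i : 'I_n.+1) : exists y, forall x, occ phi x -> e x = i -> v x = y.
  have [[x [ox ex]]|H] := pselect (exists x, occ phi x /\ e x = i).
    by exists (v x) => y oy ey; congr v; apply: einj; rewrite ?inE// ey ex.
  by have [y] := carrier_inhabited M; exists y => x ox ex; case: H; exists x.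
rewrite (@sat_ext _ _ _ v (w \o e)); last by move=> x ox /=; apply: Hw.
rewrite (@sat_ext _ _ _ (f \o v) ((f \o w) \o e)); last first.
  by move=> x ox /=; congr f; apply: Hw.
by rewrite -2!sat_rename; apply: fE.
Qed.

Lemma sat_inst (M N : structure L) (f : M -> N) X Y (x : X -> N)
    (phi : formula L (X + Y)) (a : Y -> M) :
  sat (join x f) (inst phi a) <-> sat (join x (f \o a)) phi.
Proof.
by rewrite sat_rename (_ : _ \o _ = join x (f \o a))//; apply/funext => -[].
Qed.

Lemma elementary_id (M : structure L) : elementary (id : M -> M).
Proof. by []. Qed.

Variables (T : theory L) (M : structure L).
Hypothesis M_monster : monster T M.

(** Variables are realized one after the other.  If w_0, ..., w_(n-1) satisfy all
    the formulas in n variables that hold eventually along F, then so does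
    [Ex phi] for every phi in n + 1 variables that holds eventually;
    hence the formulas phi (w_0, ..., w_(n-1), x_n) form a 1-type over a countable
    set, and saturation provides w_n. *)
Lemma realize_nat (S : Type) (F : set_system S) (FF : ProperFilter F)
    (v : S -> nat -> M) :
  exists w : nat -> M, forall phi, F [set s | sat (v s) phi] -> sat w phi.
Proof.
have [_ [K [smallK satK _]]] := M_monster.
have nat_formula : [set: nat] #<= [set: formula L nat].
  have [f] : $|{injfun [set: nat] >-> [set: formula L nat]}|.
    apply/injfunPex; exists (fun n => Equ (Var L n) (Var L n)) => // x y _ _ [].
    by [].
  exact: inj_card_le f.
(* Only the first n values of g matter in [Inv n g]. *)
pose Inv n (g : nat -> M) := forall phi : formula L 'I_n,
  F [set s | sat (v s \o val) phi] -> sat (g \o val) phi.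
have step n g : Inv n g -> exists y,
    Inv n.+1 (fun i => if (i < n)%N then g i else y).
  move=> gI; pose A := [set g i | i in [set: nat]].
  have smallA : small K A.
    move=> KA; apply: smallK; apply: card_le_trans KA _.
    by apply: card_le_trans nat_formula; apply: card_image_le.
  have Ag i : g i \in A by rewrite inE; exists i.
  (* The last variable becomes the variable of the 1-type, the others become
     parameters. *)
  pose h (i : 'I_n.+1) : unit + set_type A :=
    if (i < n)%N then inr (exist _ (g i) (Ag i)) else inl tt.
  pose Q := [set chi | exists2 phi, F [set s | sat (v s \o val) phi] &
               chi = rename h phi].
  have [|x Hx] := satK A smallA Q.
    move=> q qQ qfin.
    have QT : Q (Neg Bot) by exists (Neg Bot) => //; apply: filterE => s [].
    have QC p1 p2 : Q p1 -> Q p2 -> Q (Neg (Imp p1 (Neg p2))).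
      move=> [q1 F1 ->] [q2 F2 ->]; exists (Neg (Imp q1 (Neg q2))) => //.
      by apply: filterS2 F1 F2 => s /= h1 h2 h3; apply: h3.
    have [_ [phi Fphi ->] Hphi] := finite_conj QT QC qQ qfin.
    pose o (i : 'I_n.+1) : option 'I_n := unlift ord_max i.
    have : sat (g \o val) (Ex (rename o phi)).
      apply: gI; apply: filterS Fphi => s hs; apply/sat_Ex.
      exists (v s n); rewrite sat_rename.
      rewrite (_ : _ \o _ = v s \o val)//; apply/funext => i /=.
      by rewrite /o; case: unliftP => [j ->|->] //=; rewrite /bump leqNgt ltn_ord.
    move=> /sat_Ex[x]; rewrite sat_rename => hx; exists (fun=> x).
    apply: Hphi; rewrite sat_rename; move: hx.
    rewrite (_ : _ \o o = join (fun=> x) val \o h)//; apply/funext => i /=.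
    rewrite /o /h; case: unliftP => [j ->|->] /=; last by rewrite ltnn.
    by rewrite -[bump _ _]/(nat_of_ord (lift ord_max j)) lift_max ltn_ord.
  exists (x tt) => phi Fphi.
  have := Hx (rename h phi); rewrite sat_rename.
  rewrite (_ : _ \o h = (fun i => if (i < n)%N then g i else x tt) \o val).
    by apply; exists phi.
  by apply/funext => i /=; rewrite /h; case: ltnP => //=.
have [st Hst] : exists st : nat -> (nat -> M) -> M, forall n g, Inv n g ->
    Inv n.+1 (fun i => if (i < n)%N then g i else st n g).
  have /choice[f Hf] (ng : nat * (nat -> M)) : exists y, Inv ng.1 ng.2 ->
      Inv ng.1.+1 (fun i => if (i < ng.1)%N then ng.2 i else y).
    have [/step[y Hy]|H] := pselect (Inv ng.1 ng.2); first by exists y.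
    by have [y] := carrier_inhabited M; exists y.
  by exists (fun n g => f (n, g)) => n g; apply: (Hf (n, g)).
have [y0] := carrier_inhabited M.
pose G := fix G n := match n with
  | 0 => fun=> y0
  | n'.+1 => fun i => if (i < n')%N then G n' i else st n' (G n') end.
have GI n : Inv n (G n).
  elim: n => [|n IH]; last exact: Hst.
  move=> phi /filter_ex[s]; rewrite /=.
  by rewrite (_ : v s \o val = G 0 \o val)//; apply/funext => -[].
have Gn n m i : (i < n <= m)%N -> G m i = G n i.
  move=> /andP[ltin]; elim: m => [|m IH]; first by rewrite leqn0 => /eqP <-.
  rewrite leq_eqVlt => /predU1P[->//|]; rewrite ltnS => lenm.
  by rewrite -(IH lenm)/= (leq_trans ltin lenm).
exists (fun n => G n.+1 n) => phi Fphi.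
(* By finite support, phi is a formula in the first n.+1 variables. *)
have [n Hn] : exists n, forall x, occ phi x -> (x < n.+1)%N.
  have /finite_seqP[s Es] := finite_occ phi.
  exists (\max_(i <- s) i) => x; rewrite Es ltnS /= => xs.
  exact: (leq_bigmax_seq _ xs).
rewrite (@sat_ext _ _ _ _ ((G n.+1 \o val) \o inord)).
  rewrite -sat_rename; apply: GI; apply: filterS Fphi => s /= hs.
  rewrite sat_rename; move: hs; apply: (iffLR (sat_ext _)) => x /Hn hx /=.
  by rewrite inordK.
move=> x /Hn hx; rewrite -[LHS]/(G x.+1 x) -[RHS]/(G n.+1 (nat_of_ord (inord x))).
rewrite inordK//; symmetry; apply: (Gn x.+1).
by rewrite ltnSn.
Qed.

(** A type in countably many variables is presented here by approximate
    realizations [v s] along a filter: it consists of the formulas that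
    eventually hold. *)
Lemma realize (V : countType) (S : Type) (F : set_system S)
    (FF : ProperFilter F) (v : S -> V -> M) :
  exists w : V -> M, forall phi, F [set s | sat (v s) phi] -> sat w phi.
Proof.
have [y0] := carrier_inhabited M.
have [w Hw] := realize_nat FF (fun s n => if unpickle n is Some x then v s x else y0).
exists (w \o pickle) => phi Fphi; rewrite -sat_rename; apply: Hw.
apply: filterS Fphi => s hs; rewrite /= sat_rename.
by rewrite (_ : _ \o _ = v s)//; apply/funext => x /=; rewrite pickleK.
Qed.

End Elementary.

(** * Patterns and compactness *)

Section Patterns.
Variable L : language.

(** For every row [r], the tuple [x] satisfies [phi r (x, a l)] for [l = eta r]
    and for no other [l] in [D].  All rows read their parameters from the same
    sequence, which loses no generality since tuples can be concatenated. *)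
Definition picks (M : structure L) X Y R (phi : R -> formula L (X + Y))
    (a : nat -> Y -> M) (D : set nat) (eta : R -> nat) (x : X -> M) :=
  forall r l, D l -> (sat (join x (a l)) (phi r) <-> l = eta r).

Definition finite_pattern (M : structure L) X Y R (phi : R -> formula L (X + Y))
    (a : nat -> Y -> M) N :=
  forall eta : R -> nat, (forall r, (eta r < N)%N) ->
    exists x, picks phi a `I_N eta x.

Definition infinite_pattern (M : structure L) X Y R (phi : R -> formula L (X + Y))
    (a : nat -> Y -> M) :=
  forall eta : R -> nat, exists x, picks phi a setT eta x.

(** Concatenation of rows: the parameter variables of row r, among those of all
    the rows. *)
Definition at_row X Y R (r : R) (s : X + Y) : X + (R * Y) :=
  match s with inl x => inl x | inr y => inr (r, y) end.

Variables (T : theory L) (M : structure L).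
Hypothesis M_monster : monster T M.

(** The parameters and one realization for each path [eta] form a type in
    countably many variables. *)
Lemma compact_pattern (X Y R : finType) (phi : R -> formula L (X + Y)) :
  (forall N, exists a : nat -> Y -> M, finite_pattern phi a N) ->
  exists a : nat -> Y -> M, infinite_pattern phi a.
Proof.
have [y0] := carrier_inhabited M.
move=> /choice[a Ha].
have /choice[x Hx] (Neta : nat * {ffun R -> nat}) : exists x : X -> M,
    (forall r, (Neta.2 r < Neta.1)%N) -> picks phi (a Neta.1) `I_Neta.1 Neta.2 x.
  have [h|h] := pselect (forall r, (Neta.2 r < Neta.1)%N); last by exists (fun=> y0).
  by have [x hx] := Ha Neta.1 Neta.2 h; exists x.
(* In v N, only the realizations of the paths below N are meaningful; each path is
   below N eventually. *)
pose v N (s : nat * Y + {ffun R -> nat} * X) : M :=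
  match s with inl ly => a N ly.1 ly.2 | inr ex => x (N, ex.1) ex.2 end.
have [w Hw] := realize M_monster eventually_filter v.
exists (fun l y => w (inl (l, y))) => eta0.
pose eta := finfun eta0; exists (fun z => w (inr (eta, z))) => r l _.
pose g (s : X + Y) : nat * Y + {ffun R -> nat} * X :=
  match s with inl z => inr (eta, z) | inr y => inl (l, y) end.
have Eg : join (fun z => w (inr (eta, z))) (fun y => w (inl (l, y))) = w \o g.
  by apply/funext => -[].
rewrite Eg -sat_rename.
have : sat w (Lit (l == eta0 r) (rename g (phi r))).
  apply: Hw; exists (maxn l (\max_r eta0 r)).+1 => // N /= hN.
  apply/sat_Lit; rewrite sat_rename.
  have -> : v N \o g = join (x (N, eta)) (a N l) by apply/funext => -[].
  rewrite (Hx (N, eta) _ r l)/=.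
  - by rewrite ffunE; split=> [->|/eqP].
  - move=> r'; rewrite ffunE; apply: leq_ltn_trans hN.
    by apply: leq_trans (leq_maxr _ _); apply: leq_bigmax.
  - by apply: leq_ltn_trans hN; apply: leq_maxl.
by rewrite sat_Lit => ->; split=> /eqP.
Qed.

(** A finite part of p is realized by elements that satisfy an existential formula
    over N, and elementarity brings this formula back to N. *)
Lemma consistent_finite (N : structure L) (X J : finType)
    (p : set (formula L (X + N))) (f : J -> formula L (X + N)) :
  consistent p -> (forall j, p (f j)) ->
  exists x : X -> N, forall j, sat (join x id) (f j).
Proof.
move=> [N' [h [hE [x Hx]]]] fp.
have [psi Hpsi] := ex_closure (Conj [seq f j | j <- enum J]).
have : sat (id : N -> N) psi.
  rewrite (elementary_sat _ _ hE) Hpsi; exists x; apply/sat_Conj => j.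
  exact: Hx.
by rewrite Hpsi => -[x' /sat_Conj]; exists x'.
Qed.

(** The parameters a 0, ..., a (N - 1) become the free variables of psi. *)
Lemma picks_formula (X Y R : finType) (phi : R -> formula L (X + Y)) N
    (eta : R -> nat) :
  exists psi : formula L ('I_N * Y), forall (M' : structure L) (a : nat -> Y -> M'),
    sat (fun ly : 'I_N * Y => a ly.1 ly.2) psi <-> exists x, picks phi a `I_N eta x.
Proof.
pose g (l : 'I_N) (s : X + Y) : X + ('I_N * Y) :=
  match s with inl x => inl x | inr y => inr (l, y) end.
have [psi Hpsi] := ex_closure (Conj
  [seq Lit (rl.2 == eta rl.1 :> nat) (rename (g rl.2) (phi rl.1))
  | rl : (R * 'I_N)%type <- enum (R * 'I_N : finType)%type]).
exists psi => M' a; rewrite Hpsi.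
have E x (l : 'I_N) :
    join x (fun ly : 'I_N * Y => a ly.1 ly.2) \o g l = join x (a l).
  by apply/funext => -[].
split=> -[x].
  rewrite sat_Conj => h; exists x => r l lN.
  have := h (r, Ordinal lN); rewrite sat_Lit sat_rename E /= => ->.
  by split=> /eqP.
move=> h; exists x; rewrite sat_Conj => -[r l].
by rewrite sat_Lit sat_rename E h//=; split=> /eqP.
Qed.

(** For parameters below N only finitely many paths matter, and each of them
    contributes one formula. *)
Lemma finite_pattern_transfer (X Y R : finType) (phi : R -> formula L (X + Y))
    (N : nat) :
  exists psi : sentence L, forall M' : structure L,
    sat (of_void M') psi <->
    exists a : nat -> Y -> M', finite_pattern phi a N.
Proof.
have /choice[chi Hchi] (eta : {ffun R -> 'I_N}) :=
  picks_formula phi N (fun r => eta r).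
have [psi Hpsi] := ex_closure (rename (inl : _ -> _ + void)
   (Conj [seq chi eta | eta <- enum {ffun R -> 'I_N}])).
exists psi => M'; rewrite Hpsi.
have [y0] := carrier_inhabited M'.
split=> [[a]|[a Ha]].
  rewrite sat_rename join_inl sat_Conj => h.
  pose a' l y := if insub l is Some l' then a (l', y) else y0.
  have Ea : a = fun ly : 'I_N * Y => a' ly.1 ly.2.
    by apply/funext => -[l y]; rewrite /a' valK.
  exists a' => eta etaN.
  have := h [ffun r => Ordinal (etaN r)]; rewrite Ea Hchi => -[x hx].
  by exists x => r l lN; rewrite hx// ffunE.
exists (fun ly : 'I_N * Y => a ly.1 ly.2).
rewrite sat_rename join_inl sat_Conj => eta; apply/Hchi.
exact: Ha.
Qed.

End Patterns.

(** * Patterns with two rows and with 2 ^ n rows *)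

Section ICT.
Variable L : language.

Definition long_pattern (M : structure L) n k
    (phi : 'I_(2 ^ n) -> formula L ('I_n + 'I_k))
    (a : 'I_(2 ^ n) -> nat -> 'I_k -> M) :=
  forall eta : 'I_(2 ^ n) -> nat,
    consistent
      ([set inst (phi j) (a j (eta j)) | j in [set: 'I_(2 ^ n)]]
       `|` [set f | exists (j : 'I_(2 ^ n)) (t : nat),
              t <> eta j /\ f = Neg (inst (phi j) (a j t))]).

(** M serves as its own elementary extension. *)
Lemma consistent_realized (M : structure L) X (p : set (formula L (X + M)))
    (x : X -> M) :
  (forall phi, p phi -> sat (join x id) phi) -> consistent p.
Proof. by move=> H; exists M, id; split; [exact: elementary_id | exists x]. Qed.

(** Both formulas of the ICT pattern read the same sequence of tuples. *)
Lemma infinite_pattern_ICT (T : theory L) (M : structure L) (Y : finType)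
    (phi : bool -> formula L (unit + Y)) (a : nat -> Y -> M) :
  model T M -> dp_minimal T -> ~ infinite_pattern phi a.
Proof.
move=> TM dpT Ha; apply: (dpT M TM).
pose g (s : unit + Y) : unit + 'I_#|Y| :=
  match s with inl x => inl x | inr y => inr (enum_rank y) end.
pose a' l (i : 'I_#|Y|) := a l (enum_val i).
exists #|Y|, (rename g (phi true)), (rename g (phi false)), a', a' => i j.
have [x Hx] := Ha (fun b => if b then i else j).
have E b l : sat (join x id) (inst (rename g (phi b)) (a' l)) <->
    l = if b then i else j.
  rewrite -(Hx b l)// sat_inst sat_rename (_ : _ \o g = join x (a l))//.
  by apply/funext => -[|y]//=; rewrite /a' enum_rankK.
apply: (@consistent_realized _ _ _ x) => f.
move=> [[[->|->]|[l li <-]]|[l lj <-]].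
- exact/E.
- exact/E.
- by apply/sat_Neg => /E.
- by apply/sat_Neg => /E.
Qed.

Lemma long_pattern_finite (M : structure L) n k phi
    (a : 'I_(2 ^ n) -> nat -> 'I_k -> M) N :
  long_pattern phi a ->
  finite_pattern (fun r : 'I_(2 ^ n) => rename (at_row r) (phi r))
    (fun l (ry : 'I_(2 ^ n) * 'I_k) => a ry.1 l ry.2) N.
Proof.
move=> H eta etaN.
pose f (rl : 'I_(2 ^ n) * 'I_N) :=
  Lit (rl.2 == eta rl.1 :> nat) (inst (phi rl.1) (a rl.1 rl.2)).
have [|x Hx] := consistent_finite (f := f) (H eta).
  move=> [r l]; rewrite /f /=; case: eqP => [->|ne] /=; first by left; exists r.
  by right; exists r, l.
exists x => r l lN; rewrite sat_rename.
have := Hx (r, Ordinal lN); rewrite sat_Lit sat_inst /=.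
rewrite (_ : _ \o _ = join x (id \o a r l)); last by apply/funext => -[].
by move=> ->; split=> /eqP.
Qed.

Variables (T : theory L) (M : structure L).
Hypothesis T_complete : complete T.
Hypothesis M_monster : monster T M.

(** The finite parts of an ICT pattern live in the model itself, are expressed
    by sentences and hence occur in M, where compactness puts them together. *)
Lemma no_long_pattern_dp_minimal :
  (~ exists k (phi : 'I_(2 ^ 1) -> formula L ('I_1 + 'I_k))
       (a : _ -> _ -> _ -> M), long_pattern phi a) ->
  dp_minimal T.
Proof.
move=> Hno M' TM' [k [phi [psi [a [b Hab]]]]]; apply: Hno.
pose chi (r : 'I_(2 ^ 1)) := if r == 0 :> nat then phi else psi.
pose c (r : 'I_(2 ^ 1)) := if r == 0 :> nat then a else b.
pose Y := ('I_(2 ^ 1) * 'I_k)%type.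
pose g (r : 'I_(2 ^ 1)) (s : unit + 'I_k) : 'I_1 + Y :=
  match s with inl _ => inl ord0 | inr y => inr (r, y) end.
have fin N : finite_pattern (fun r => rename (g r) (chi r))
    (fun l (ry : Y) => c ry.1 l ry.2) N.
  move=> eta etaN.
  have lt0 : (0 < 2 ^ 1)%N by [].
  have lt1 : (1 < 2 ^ 1)%N by [].
  pose f (rl : 'I_(2 ^ 1) * 'I_N) :=
    Lit (rl.2 == eta rl.1 :> nat) (inst (chi rl.1) (c rl.1 rl.2)).
  have [|x Hx] := consistent_finite (f := f)
      (Hab (eta (Ordinal lt0)) (eta (Ordinal lt1))).
    move=> [[[|[|//]] rlt] l]; rewrite /f /chi /c /=.
      rewrite (bool_irrelevance rlt lt0); case: eqP => [->|ne] /=.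
        by left; left; left.
      by left; right; exists (l : nat).
    rewrite (bool_irrelevance rlt lt1); case: eqP => [->|ne] /=.
      by left; left; right.
    by right; exists (l : nat).
  exists (fun=> x tt) => r l lN; rewrite sat_rename.
  have := Hx (r, Ordinal lN); rewrite sat_Lit sat_inst /=.
  rewrite (_ : _ \o _ = join x (id \o c r l)).
    by move=> ->; split=> /eqP.
  by apply/funext => -[[]|].
have [TM _] := M_monster.
have [|A HA] := @compact_pattern _ _ _ M_monster 'I_1 Y 'I_(2 ^ 1)
    (fun r => rename (g r) (chi r)).
  move=> N.
  have [sent Hsent] := finite_pattern_transfer (fun r => rename (g r) (chi r)) N.
  apply/Hsent; have [_ /(_ sent) [|H]] := T_complete; first exact.
  have [] := H M' TM'; apply/Hsent.
  by exists (fun l (ry : Y) => c ry.1 l ry.2).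
pose g1 (s : unit + 'I_k) : 'I_1 + 'I_k :=
  match s with inl _ => inl ord0 | inr y => inr y end.
exists k, (fun r => rename g1 (chi r)), (fun r l y => A l (r, y)) => eta.
have [x Hx] := HA eta.
have E r l : sat (join x id) (inst (rename g1 (chi r)) (fun y => A l (r, y))) <->
    l = eta r.
  rewrite -(Hx r l)// sat_inst !sat_rename (_ : _ \o _ = join x (A l) \o g r)//.
  by apply/funext => -[].
apply: (@consistent_realized _ _ _ x) => f [[r _ <-]|[r [t [ne ->]]]].
  exact/E.
by apply/sat_Neg => /E.
Qed.

End ICT.

(** * Indiscernible sequences from powers of an ultrafilter *)

Section Tensor.
Variable U : set_system nat.
Hypothesis UU : UltraFilter U.
Hypothesis U_free : forall n, U [set i | i <> n].

Lemma ultraC A : U (~` A) <-> ~ U A.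
Proof.
split=> [UC UA|nUA]; last by have [] := in_ultra_setVsetC A UU.
have : U (A `&` ~` A) by apply: filterI.
by rewrite setICr; apply: filter_not_empty.
Qed.

(** [tensor m P]: for U-many i_1, for U-many i_2, ..., for U-many i_m,
    P [:: i_1; ...; i_m] holds. *)
Fixpoint tensor m (P : seq nat -> Prop) : Prop :=
  if m is m'.+1 then U [set i | tensor m' (fun l => P (i :: l))] else P [::].

Variables (d : Order.disp_t) (J : orderType d).

Definition upd (g : J -> nat) j i : J -> nat := fun j' => if j' == j then i else g j'.

(** The same iterated quantifier, over the values at the indices js of a function
    that coincides with g elsewhere. *)
Fixpoint iterU (js : seq J) (g : J -> nat) (A : set (J -> nat)) : Prop :=
  if js is j :: js' then U [set i | iterU js' (upd g j i) A] else A g.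

Lemma iterU_mono js g (A B : set (J -> nat)) : A `<=` B -> iterU js g A -> iterU js g B.
Proof.
move=> AB; elim: js g => [|j js IH] g /=; first exact: AB.
by apply: filterS => i; apply: IH.
Qed.

Lemma iterU_and js g A B : iterU js g A -> iterU js g B -> iterU js g (A `&` B).
Proof.
elim: js g => [|j js IH] g //=.
by apply: filterS2 => i; apply: IH.
Qed.

Lemma iterUT js g : iterU js g setT.
Proof. by elim: js g => [|j js IH] g //=; apply: filterE => i; apply: IH. Qed.

Lemma iterU_not js g A : iterU js g (~` A) <-> ~ iterU js g A.
Proof.
elim: js g => [|j js IH] g //=; rewrite -ultraC.
by split; apply: filterS => i /IH.
Qed.

(** A value outside of js is not changed by the quantifiers over js. *)
Lemma iterU_fixed js j g A : j \notin js ->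
  iterU js g [set h | h j = g j -> A h] -> iterU js g A.
Proof.
elim: js g => [|j' js IH] g /=; first by move=> _; apply.
rewrite inE negb_or => /andP[jj' jjs]; apply: filterS => i H.
by apply: IH => //; apply: iterU_mono H => h; rewrite /upd (negbTE jj').
Qed.

(** Quantifiers over indices outside of the subsequence s are idle. *)
Lemma iterU_tensor js s g P : uniq js -> subseq s js ->
  iterU js g [set h | P (map h s)] <-> tensor (size s) P.
Proof.
elim: js s g P => [|j js IH] s g P /=; first by move=> _ /eqP ->.
move=> /andP[jjs ujs]; case: s => [_|j' s].
  rewrite /=; have E i := IH [::] (upd g j i) P ujs (sub0seq _).
  split=> [/filter_ex[i /E]//|h]; apply: filterE => i; exact/E.
case: eqP => [->|_] sub; last first.
  have E i := IH (j' :: s) (upd g j i) P ujs sub.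
  split=> [/filter_ex[i /E]//|h]; apply: filterE => i; exact/E.
rewrite /=; split; apply: filterS => i /= H.
  rewrite -(IH _ (upd g j i) (fun l => P (i :: l)) ujs sub).
  apply: (@iterU_fixed _ j) => //; apply: iterU_mono H => h /=.
  by rewrite /upd eqxx => + <-.
apply: (@iterU_fixed _ j) => //.
move: H; rewrite -(IH _ (upd g j i) (fun l => P (i :: l)) ujs sub).
by apply: iterU_mono => h /=; rewrite /upd eqxx => + ->.
Qed.

(** The power of U indexed by J, as a filter on J -> nat.  Requiring the property
    for all js large enough makes the closure under intersection immediate. *)
Definition tensor_filter : set_system (J -> nat) :=
  [set A | exists js0 : seq J, forall js, sorted <%O js -> {subset js0 <= js} ->
     forall g, iterU js g A].

Lemma sorted_cover (js0 : seq J) : exists2 js, sorted <%O js & {subset js0 <= js}.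
Proof.
exists (sort <=%O (undup js0)).
  by rewrite sort_lt_sorted undup_uniq.
by move=> j; rewrite mem_sort mem_undup.
Qed.

Lemma tensor_filter_proper : ProperFilter tensor_filter.
Proof.
apply: Build_ProperFilter_ex.
  move=> A [js0 H]; have [js sjs sub] := sorted_cover js0.
  apply: contrapT => nA; have := H js sjs sub (fun=> 0).
  have -> : A = ~` setT.
    by rewrite setCT; apply/seteqP; split=> // x Ax; case: nA; exists x.
  by rewrite iterU_not; apply; apply: iterUT.
split.
- by exists [::] => *; apply: iterUT.
- move=> A B [js1 H1] [js2 H2]; exists (js1 ++ js2) => js sjs sub g.
  by apply: iterU_and; [apply: H1|apply: H2] => // j hj; apply: sub;
    rewrite mem_cat hj ?orbT.
- by move=> A B AB [js0 H]; exists js0 => js sjs sub g; apply: iterU_mono AB _; apply: H.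
Qed.

Lemma sorted_sub_subseq (s js : seq J) : sorted <%O s -> sorted <%O js ->
  {subset s <= js} -> subseq s js.
Proof.
move=> ss sjs sub; have -> : s = [seq x <- js | x \in s]; last exact: filter_subseq.
apply: lt_sorted_eq => //.
  by apply: lt_sorted_filter.
by move=> x; rewrite mem_filter; case: (boolP (x \in s)) => // /sub ->.
Qed.

(** By [iterU_tensor] whether P holds along s for almost all h depends on the
    length of s only.  This is what makes the limit indiscernible. *)
Lemma tensor_filter_indiscernible (s t : seq J) P :
  sorted <%O s -> sorted <%O t -> size s = size t ->
  tensor_filter [set h | P (map h s) <-> P (map h t)].
Proof.
move=> ss st sz; exists (s ++ t) => js sjs sub g.
have ujs : uniq js by apply: lt_sorted_uniq.
have sub1 : subseq s js.
  by apply: sorted_sub_subseq => // j hj; apply: sub; rewrite mem_cat hj.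
have sub2 : subseq t js.
  by apply: sorted_sub_subseq => // j hj; apply: sub; rewrite mem_cat hj orbT.
have [h|h] := pselect (tensor (size s) P).
  have h1 := (iterU_tensor g P ujs sub1).2 h.
  rewrite sz in h; have h2 := (iterU_tensor g P ujs sub2).2 h.
  by apply: iterU_mono (iterU_and h1 h2) => x [].
have h1 : iterU js g (~` [set h | P (map h s)]) by rewrite iterU_not iterU_tensor.
have h2 : iterU js g (~` [set h | P (map h t)]) by rewrite iterU_not iterU_tensor -?sz.
by apply: iterU_mono (iterU_and h1 h2) => x [] /=.
Qed.

Lemma tensor_filter_injective j j' : j != j' -> tensor_filter [set h | h j <> h j'].
Proof.
wlog jj' : j j' / (j < j')%O.
  move=> H ne; have [/H|/H|E] := ltgtP j j'.
  - exact.
  - rewrite eq_sym => /(_ ne) [js0 H0]; exists js0 => js h1 h2 g.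
    by apply: iterU_mono (H0 js h1 h2 g) => h /= ne' /esym.
  - by rewrite E eqxx in ne.
move=> _; exists [:: j; j'] => js sjs sub g.
have ujs : uniq js by apply: lt_sorted_uniq.
have sub' : subseq [:: j; j'] js by apply: sorted_sub_subseq => //=; rewrite jj'.
apply: (iterU_tensor g (fun l => nth 0 l 0 <> nth 0 l 1) ujs sub').2 => /=.
apply: filterE => i; rewrite /=; apply: filterS (U_free i) => i' /= ne e.
exact/ne/esym.
Qed.

End Tensor.

Lemma free_ultrafilter : exists2 U : set_system nat, UltraFilter U &
  forall n, U [set i | i <> n].
Proof.
have [U [UU sub]] := ultraFilterLemma eventually_filter.
exists U => // n; apply: sub; exists n.+1 => // i /= lni e.
by rewrite e ltnn in lni.
Qed.

Section Stretch.
Variables (L : language) (T : theory L) (M : structure L).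
Hypothesis M_monster : monster T M.

(** Any sequence over omega can be replaced by an indiscernible one indexed by
    any countable linear order, preserving the patterns: the new sequence
    realizes the limit of the given sequence along the power of a free
    ultrafilter. *)
Lemma indiscernible_pattern (X Y R : finType) (phi : R -> formula L (X + Y))
    (a : nat -> Y -> M) d (J : orderType d) (code : J -> nat) (eta : R -> J) :
  injective code -> infinite_pattern phi a ->
  exists (e : J -> 'I_#|Y| -> M) (x : X -> M), indiscernible e /\
    forall r j, sat (join x (e j \o enum_rank)) (phi r) <-> j = eta r.
Proof.
move=> code_inj pat.
have [U UU U_free] := free_ultrafilter.
pose F := @tensor_filter U d J.
have FF : ProperFilter F := tensor_filter_proper UU J.
have /choice[x Hx] (g : J -> nat) := pat (g \o eta).
have [y0] := carrier_inhabited M.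
have [inv Hinv] : exists inv : nat -> option J, pcancel code inv.
  have /choice[inv Hinv] (n : nat) : exists o : option J, forall j, code j = n -> o = Some j.
    have [[j <-]|H] := pselect (exists j, code j = n).
      by exists (Some j) => j' /code_inj ->.
    by exists None => j cj; case: H; exists j.
  by exists inv => j; apply: Hinv.
pose v (g : J -> nat) (s : nat * Y + X) : M :=
  match s with
  | inl ny => if inv ny.1 is Some j then a (g j) ny.2 else y0
  | inr z => x g z end.
have [w Hw] := realize M_monster FF v.
exists (fun j i => w (inl (code j, enum_val i))), (fun z => w (inr z)); split.
  suff incl m (s t : 'I_m -> J) :
      (forall u v : 'I_m, (u < v)%N -> (s u < s v)%O) ->
      (forall u v : 'I_m, (u < v)%N -> (t u < t v)%O) ->
      tp (fun p : 'I_m * 'I_#|Y| => w (inl (code (s p.1), enum_val p.2))) (of_void M) `<=`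
      tp (fun p : 'I_m * 'I_#|Y| => w (inl (code (t p.1), enum_val p.2))) (of_void M).
    by move=> m s t _ _ hs ht; apply/seteqP; split; apply: incl.
  move=> hs ht chi; rewrite /tp /=.
  have sorted_codom (r : 'I_m -> J) :
      (forall u v : 'I_m, (u < v)%N -> (r u < r v)%O) -> sorted <%O (codom r).
    move=> hr; rewrite codomE sorted_map.
    have : sorted ltn (map val (enum 'I_m)) by rewrite val_enum_ord iota_ltn_sorted.
    rewrite sorted_map; apply: sub_sorted => u u' /=; exact: hr.
  pose P (l : seq nat) := sat (join (fun p : 'I_m * 'I_#|Y| =>
    a (nth 0 l p.1) (enum_val p.2)) (of_void M)) chi.
  pose gr (r : 'I_m -> J) (q : 'I_m * 'I_#|Y| + void) : nat * Y + X :=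
    match q with inl p => inl (code (r p.1), enum_val p.2) | inr z => match z with end end.
  have E r h : sat (v h) (rename (gr r) chi) <-> P (map h (codom r)).
    rewrite sat_rename /P.
    have -> // : v h \o gr r = join (fun p : 'I_m * 'I_#|Y| =>
        a (nth 0 (map h (codom r)) p.1) (enum_val p.2)) (of_void M).
    apply/funext => -[p|[]] /=; rewrite Hinv; congr a.
    by rewrite codomE -map_comp (nth_map p.1) ?size_enum_ord// nth_ord_enum.
  have E' r : join (fun p : 'I_m * 'I_#|Y| => w (inl (code (r p.1), enum_val p.2)))
      (of_void M) = w \o gr r by apply/funext => -[|[]].
  rewrite !E' -(sat_rename (gr s)) -(sat_rename (gr t)) => hsat.
  suff : sat w (Imp (rename (gr s) chi) (rename (gr t) chi)) by apply.
  apply: Hw; apply: filterS (tensor_filter_indiscernible UU P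
    (sorted_codom s hs) (sorted_codom t ht) _) => [h /= hP|].
    by move=> hs'; apply/(E t h)/(hP.1 _)/(E s h).
  by rewrite !size_codom.
move=> r j.
pose g0 (s : X + Y) : nat * Y + X :=
  match s with inl z => inr z | inr y => inl (code j, y) end.
rewrite (_ : join _ _ = w \o g0); last by apply/funext => -[|y]//=; rewrite enum_rankK.
rewrite -sat_rename.
have : sat w (Lit (j == eta r) (rename g0 (phi r))).
  apply: Hw.
  have E h : sat (v h) (rename g0 (phi r)) <-> h j = h (eta r).
    rewrite sat_rename -(Hx h r)// (_ : _ \o g0 = join (x h) (a (h j)))//.
    by apply/funext => -[|y]//=; rewrite Hinv.
  case: eqVneq => [je|ne]; first by apply: filterE => h; apply/E; rewrite je.
  apply: filterS (tensor_filter_injective UU U_free ne) => h /= ne' /=.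
  by move=> /E.
by rewrite sat_Lit => ->; split=> /eqP.
Qed.

End Stretch.

(** * A long pattern forces many infinite pieces *)

Section Count.
Variables (L : language) (T : theory L) (M : structure L).
Hypothesis M_monster : monster T M.

(** The 2 ^ n distinguished indices delimit 2 ^ n + 1 infinite intervals, and a
    convex set that meets two of them contains a distinguished index. *)
Lemma constant_types_no_long_pattern n :
  (forall (d : Order.disp_t) (I : orderType d) (k : nat)
      (a : I -> 'I_k -> M) (c : 'I_n -> M),
    indiscernible a ->
    exists (m : nat) (P : 'I_m -> set I),
      convex_partition (2 ^ n) P /\
      forall (l : 'I_m) (i j : I), P l i -> P l j -> tp (a i) c = tp (a j) c) ->
  ~ exists k (phi : 'I_(2 ^ n) -> formula L ('I_n + 'I_k))
      (a : _ -> _ -> _ -> M), long_pattern phi a.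
Proof.
move=> H2 [k [phi [a Ha]]].
have [|a' Ha'] := compact_pattern M_monster
    (phi := fun r : 'I_(2 ^ n) => rename (at_row r) (phi r)).
  by move=> N; exists (fun l ry => a ry.1 l ry.2); apply: long_pattern_finite.
pose J := (nat *l nat)%type.
pose eta (r : 'I_(2 ^ n)) : J := (r.+1, 0).
have [e [x [e_ind Hx]]] := indiscernible_pattern M_monster (J := J) eta
  (pcan_inj (@pickleK J)) Ha'.
have [m [P [[[Pcover Ptriv Pne] Pconv Pcard] Ptp]]] := H2 _ _ _ e x e_ind.
pose K := 2 ^ n.
(* The points strictly between (k, 0) and (k.+1, 0). *)
pose block (k : 'I_K.+1) : set J := [set ((k : nat, t.+1) : J) | t in [set: nat]].
have /choice[l Hl] (b : 'I_K.+1) : exists l, infinite_set (P l `&` block b).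
  apply: contrapT => /forallNP Hfin.
  apply: infinite_nat.
  have : finite_set (block b).
    have -> : block b = \bigcup_(i in [set: 'I_m]) (P i `&` block b).
      by rewrite -setI_bigcupl -/(cover _ _) Pcover setTI.
    by apply: bigcup_finite => // i _; apply: contrapT.
  move=> /(finite_preimage (f := fun t : nat => (b : nat, t.+1) : J)) fin.
  apply: sub_finite_set (fin _) => [t _|t t' _ _ []//].
  by exists t.
have l_inj : injective l.
  have wl (b b' : 'I_K.+1) : (b < b')%N -> l b <> l b'.
    move=> bb' E.
    have [j1 [Pi [t _ ti]]] : (P (l b) `&` block b) !=set0.
      by apply: infinite_setN0; apply: Hl.
    have [j2 [Pi' [t' _ ti']]] : (P (l b') `&` block b') !=set0.
      by apply: infinite_setN0; apply: Hl.
    move: Pi Pi'; rewrite -ti -ti' -E => Pi Pi'.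
    have bK : (b < K)%N by apply: leq_trans bb' _; rewrite -ltnS.
    have Pm : P (l b) ((b.+1, 0) : J).
      apply: Pconv Pi Pi' _.
      by rewrite !lexi_pair !leEnat leqnSn ltnn /= leq0n implybT andbT.
    have E2 := Ptp _ _ _ Pi Pm.
    pose r := Ordinal bK.
    pose chi : formula L ('I_#|('I_K * 'I_k : finType)%type| + 'I_n) :=
      rename (fun s : 'I_n + 'I_k =>
        match s with inl z => inr z | inr y => inl (enum_rank (r, y)) end) (phi r).
    have F j : tp (e j) x chi <-> j = eta r.
      rewrite -Hx /tp /= !sat_rename.
      rewrite (_ : _ \o _ = join x (e j \o enum_rank) \o at_row r)//.
      by apply/funext => -[].
    have : tp (e (b.+1, 0)) x chi by apply/F.
    by rewrite -E2 => /F [].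
  move=> b b' lE; have [lt|lt|/val_inj//] := ltngtP b b'.
    by case: (wl _ _ lt lE).
  by case: (wl _ _ lt (esym lE)).
have : (K.+1 <= #|[pred l : 'I_m | `[< infinite_set (P l) >]]|)%N.
  rewrite -[X in (X <= _)%N]card_ord -(card_codom l_inj).
  apply: subset_leq_card; apply/fintype.subsetP => _ /codomP[b ->]; rewrite unfold_in /=.
  apply/asboolP => Pfin; apply: (Hl b); apply: sub_finite_set Pfin.
  by move=> ? [].
by rewrite ltnNge Pcard.
Qed.

End Count.

(** * Selecting blocks with one prescribed change *)

Definition incr m d (I : orderType d) (s : 'I_m -> I) :=
  forall u v : 'I_m, (u < v)%N -> (s u < s v)%O.

Lemma majority K (f : nat -> Prop) :
  exists (b : bool) (lam : nat -> nat),
    [/\ forall l, (l < K)%N -> (lam l < K.*2)%N,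
        forall l l', (l < l' < K)%N -> (lam l < lam l')%N &
        forall l, (l < K)%N -> f (lam l) <-> b].
Proof.
pose s b := [seq l <- iota 0 K.*2 | `[< f l >] == b].
have sz : (size (s true) + size (s false) = K.*2)%N.
  rewrite !size_filter -[RHS](size_iota 0).
  rewrite -(count_predC (fun l => `[< f l >] == true)); congr (_ + _)%N.
  by apply: eq_count => l /=; case: asboolP.
have [b Kb] : exists b, (K <= size (s b))%N.
  by case: (leqP K (size (s true))) => h; [exists true|exists false; lia].
exists b, (nth 0 (s b)).
have mem l : (l < K)%N -> nth 0 (s b) l \in s b.
  by move=> lK; apply: mem_nth; apply: leq_trans Kb.
split=> [l /mem|l l' /andP[ll' lK]|l /mem].
- by rewrite mem_filter mem_iota => /andP[_ /andP[]].
- apply: (sorted_ltn_nth ltn_trans) => //.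
  + by apply: sorted_filter (iota_ltn_sorted _ _); apply: ltn_trans.
  + by rewrite inE; lia.
  + by rewrite inE; lia.
- rewrite mem_filter => /andP[/eqP fb _].
  by rewrite -[X in _ <-> is_true X]fb; exact: (rwP (asboolP _)).
Qed.

Definition block m (beta : nat -> nat) q : 'I_m -> nat := fun u => beta (q * m + u)%N.

(** A set of m-tuples of naturals that separates two increasing tuples s and t
    surrounded by enough room can be made to change inside one prescribed pair of
    consecutive blocks and inside no other pair.  The majority values on the left
    and on the right of s and t either differ, and then the passage from left to
    right is put inside the pair, or agree, and then s or t has the other value and
    is put first in the pair. *)
Lemma row_selection m N base Z (bit : ('I_m -> nat) -> Prop) (s t : 'I_m -> nat) i :
  (N * 4 * m <= Z)%N -> (i < N)%N ->
  incr s -> incr t ->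
  (forall u, base + Z <= s u < base + Z * 2)%N ->
  (forall u, base + Z <= t u < base + Z * 2)%N ->
  ~ (bit s <-> bit t) ->
  exists beta : nat -> nat,
    [/\ forall p, (p < N * 2 * m)%N -> (base <= beta p < base + Z * 3)%N,
        forall p q, (p < q < N * 2 * m)%N -> (beta p < beta q)%N &
        forall l, (l < N)%N ->
          ~ (bit (@block m beta (l * 2)) <-> bit (@block m beta (l * 2).+1)) <-> l = i].
Proof.
case: m => [|m] in bit s t *.
  by move=> _ _ _ _ _ _ []; rewrite (_ : s = t)//; apply/funext => -[].
move=> hZ iN sI tI sZ tZ st.
pose lft l := fun u : 'I_m.+1 => (base + (l * m.+1 + u))%N.
pose rgt l := fun u : 'I_m.+1 => (base + Z * 2 + (l * m.+1 + u))%N.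
have [b [lam [lam2 lamI lamb]]] := majority (N * 2) (bit \o lft).
have [b' [lam' [lam2' lamI' lamb']]] := majority (N * 2) (bit \o rgt).
have [w [c0 [wI wZ c0i wb]]] : exists w c0, [/\ incr w,
    forall u : 'I_m.+1, (base + Z <= w u < base + Z * 2)%N,
    c0 = (i * 2)%N \/ c0 = (i * 2).+1 &
    if c0 == (i * 2)%N then b = b' /\ ~ (bit w <-> b) else b != b'].
  have [bb|bb] := eqVneq b b'; last first.
    by exists s, (i * 2).+1; split=> //; [right|rewrite eqn_leq ltnn].
  have [bs|bs] := pselect (bit s <-> b).
    by exists t, (i * 2); split=> //; [left|rewrite eqxx; split=> //; tauto].
  by exists s, (i * 2); split=> //; [left|rewrite eqxx].
(* Blocks on the left, then w unless c0 = (i * 2).+1, then blocks on the right. *)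
pose B q := if (q < c0)%N then lft (lam q) else if (q <= i * 2)%N then w else rgt (lam' q).
have BI q : incr (B q).
  move=> u v uv; rewrite /B; case: ifP => _; [|case: ifP => _; [exact: wI|]];
  by rewrite /lft/rgt ltEnat /= !ltn_add2l.
have BZ q u : (q < N * 2)%N -> (base <= B q u < base + Z * 3)%N.
  move=> qN; have um := ltn_ord u; rewrite /B /lft /rgt; case: ifP => _; [|case: ifP => _].
  - have := lam2 q qN => h; nia.
  - have := wZ u; lia.
  - have := lam2' q qN => h; nia.
have BB q q' u u' : (q < q' < N * 2)%N -> (B q u < B q' u')%N.
  move=> /andP[qq' q'N]; have um := ltn_ord u; have um' := ltn_ord u'.
  have h1 := lamI q q'; have h2 := lamI' q q'; have h3 := lam2 q; have h4 := lam2' q'.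
  have := wZ u; have := wZ u'; rewrite /B /lft /rgt.
  by case: (ltnP q c0) => ?; case: (ltnP q' c0) => ?; case: (leqP q (i * 2)) => ?;
    case: (leqP q' (i * 2)) => ? ? ?; try (exfalso; lia); try nia.
pose beta p := B (p %/ m.+1) (inord (p %% m.+1)).
have betaE q : @block m.+1 beta q = B q.
  apply/funext => u; rewrite /block /beta divnMDl// modnMDl.
  by rewrite divn_small// addn0 modn_small// inord_val.
exists beta; split=> [p hp|p q /andP[pq qN]|l lN].
- by apply: BZ; rewrite ltn_divLR.
- have qN' : (q %/ m.+1 < N * 2)%N by rewrite ltn_divLR.
  have := leq_div2r m.+1 (ltnW pq); rewrite leq_eqVlt => /predU1P[e|lt].
    rewrite /beta e; apply: BI; rewrite !inordK ?ltn_pmod//.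
    by move: pq; rewrite {1}(divn_eq p m.+1) {1}(divn_eq q m.+1) e ltn_add2l.
  by apply: BB; rewrite lt.
- rewrite !betaE.
  have Bl q : (q < c0)%N -> (q < N * 2)%N -> bit (B q) <-> b.
    by move=> qc qN; rewrite /B qc; apply: lamb.
  have Br q : (i * 2 < q < N * 2)%N -> bit (B q) <-> b'.
    move=> qc; rewrite /B ifF; last by apply/negbTE; lia.
    by rewrite ifF; [apply: lamb'|apply/negbTE]; lia.
  have [-> | li] := eqVneq l i.
    split=> // _; rewrite (Br (i * 2).+1); last lia.
    have [c0E|c0E] := c0i.
      have -> : B (i * 2) = w by rewrite /B c0E ltnn leqnn.
      by move: wb; rewrite c0E eqxx => -[<-].
    rewrite Bl ?c0E//; last lia.
    have := wb; rewrite c0E ifF; last by apply/negbTE; lia.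
    by case: (b) (b') => -[] //= _ h; have := h.1; have := h.2; intuition.
  split=> [h|/eqP]; last by rewrite (negbTE li).
  exfalso; apply: h; have [lt|ge] := ltnP l i.
    by rewrite !Bl//; lia.
  by rewrite !Br//; lia.
Qed.

(** * Indiscernibility over parameters *)

Section Chains.
Variables (d : Order.disp_t) (I : orderType d).

Lemma infinite_chain (D : set I) B : infinite_set D ->
  exists e : nat -> I, (forall p, (p < B)%N -> D (e p)) /\
    forall p q, (p < q < B)%N -> (e p < e q)%O.
Proof.
move=> Dinf; have [F FD BF] := infinite_set_fset B Dinf.
have [i0 _] := infinite_setN0 Dinf.
pose s := sort <=%O (finmap.enum_fset F).
have szs : (B <= size s)%N by rewrite size_sort.
exists (nth i0 s); split=> [p pB|p q /andP[pq qB]].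
  apply: FD; rewrite /= -(mem_sort <=%O).
  by apply: mem_nth; apply: leq_trans szs.
rewrite (lt_sorted_ltn_nth i0)//.
- by rewrite sort_lt_sorted finmap.fset_uniq.
- by rewrite inE (leq_trans (ltn_trans pq qB)).
- by rewrite inE (leq_trans qB).
Qed.

Definition rank (F : seq I) i := count (fun f => (f < i)%O) F.

Lemma rank_lt F i j : i \in F -> (i < j)%O -> (rank F i < rank F j)%N.
Proof.
move=> + ij; elim: F => //= f F IH; rewrite inE => /predU1P[<-|/IH h].
  rewrite ltxx ij add0n add1n ltnS.
  by apply: sub_count => x /lt_trans; apply.
rewrite -/(rank F i) -/(rank F j).
by have [fi|_] := boolP (f < i)%O; first rewrite (lt_trans fi ij); lia.
Qed.

End Chains.

Section Indiscernible.
Variables (L : language) (M : structure L).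
Variables (d : Order.disp_t) (I : orderType d) (k : nat) (a : I -> 'I_k -> M).

Lemma not_indiscernible W (E : set I) (c : W -> M) :
  ~ indiscernible_over E a c ->
  exists m (s t : 'I_m -> I) (theta : formula L (('I_m * 'I_k) + W)),
    [/\ forall u, E (s u), forall u, E (t u), incr s, incr t &
      ~ (sat (join (fun p => a (s p.1) p.2) c) theta <->
         sat (join (fun p => a (t p.1) p.2) c) theta)].
Proof.
move=> H; apply: contrapT => H'; apply: H => m s t sE tE sI tI.
apply/seteqP; split=> theta; rewrite /tp /= => h; apply: contrapT => h';
by apply: H'; exists m, s, t, theta; split=> //; tauto.
Qed.

(** Indiscernibility speaks of increasing tuples only; a finite family H of indices,
    in any order and with repetitions, reduces to the increasing tuple of its
    values. *)
Lemma indiscernible_mono W (D : set I) (c : W -> M) (X : finType) (H : X -> I)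
    (g : I -> I) (Th : formula L ((X * 'I_k) + W)) :
  indiscernible_over D a c ->
  (forall x, D (H x)) -> (forall x, D (g (H x))) ->
  (forall x y, (H x < H y)%O -> (g (H x) < g (H y))%O) ->
  sat (join (fun p => a (H p.1) p.2) c) Th <->
  sat (join (fun p => a (g (H p.1)) p.2) c) Th.
Proof.
move=> aD HD gHD gmono.
pose h := sort <=%O (undup (codom H)).
have hE : h =i codom H by move=> i; rewrite mem_sort mem_undup.
have hs : sorted <%O h by rewrite sort_lt_sorted undup_uniq.
have Hh x : H x \in h by rewrite hE codom_f.
pose s (u : 'I_(size h)) := tnth (in_tuple h) u.
have sE u : exists x, s u = H x.
  have : s u \in codom H by rewrite -hE mem_tnth.
  by move=> /codomP[x ->]; exists x.
have sI : incr s.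
  move=> u v uv; rewrite /s !(tnth_nth (s u)) /=.
  by rewrite (lt_sorted_ltn_nth (s u) hs) ?inE.
pose idx x : 'I_(size h) := Ordinal (etrans (index_mem (H x) h) (Hh x)).
have sidx x : s (idx x) = H x by rewrite /s (tnth_nth (H x)) nth_index.
have := aD _ s (g \o s).
move=> /(_ _ _ sI) H4.
have {H4} E : tp (fun p : 'I_(size h) * 'I_k => a (s p.1) p.2) c =
  tp (fun p : 'I_(size h) * 'I_k => a (g (s p.1)) p.2) c.
  apply: H4.
  - by move=> u; have [x ->] := sE u.
  - by move=> u; have [x /= ->] := sE u.
  - move=> u v uv /=; have [x ux] := sE u; have [y vy] := sE v.
    by rewrite ux vy; apply: gmono; rewrite -ux -vy; apply: sI.
pose r (p : X * 'I_k + W) := match p with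
  | inl q => inl (idx q.1, q.2) | inr w => inr w end.
have Er (f : I -> I) : join (fun p : X * 'I_k => a (f (H p.1)) p.2) c =
    join (fun p : 'I_(size h) * 'I_k => a (f (s p.1)) p.2) c \o r.
  by apply/funext => -[q|]//=; rewrite sidx.
rewrite (Er id) (Er g) -2!sat_rename.
by have := congr1 (fun S => S (rename r Th)) E; rewrite /tp /= => ->.
Qed.

Lemma indiscernible_over_comp W W' (D : set I) (c : W -> M) (g : W' -> W) :
  indiscernible_over D a c -> indiscernible_over D a (c \o g).
Proof.
move=> H m s t sD tD sI tI; have E := H m s t sD tD sI tI.
pose r (p : 'I_m * 'I_k + W') : 'I_m * 'I_k + W :=
  match p with inl q => inl q | inr w => inr (g w) end.
have Er (f : 'I_m -> I) : join (fun p : 'I_m * 'I_k => a (f p.1) p.2) (c \o g) =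
  join (fun p : 'I_m * 'I_k => a (f p.1) p.2) c \o r by apply/funext => -[].
apply/seteqP; split=> theta; rewrite /tp /= !Er -!(sat_rename r);
by have := congr1 (fun S => S (rename r theta)) E; rewrite /tp /= => ->.
Qed.

Lemma indiscernible_over_sub W (D D' : set I) (c : W -> M) : D' `<=` D ->
  indiscernible_over D a c -> indiscernible_over D' a c.
Proof. by move=> DD H m s t sD tD; apply: H => u; apply: DD. Qed.

(** Two finite tuples of indices lie below the larger of their last entries. *)
Lemma indiscernible_le W (D : set I) (c : W -> M) :
  (forall i, D i -> indiscernible_over [set j | D j /\ (j <= i)%O] a c) ->
  indiscernible_over D a c.
Proof.
move=> H [|m] s t sD tD sI tI.
  by congr tp; apply/funext => -[[]].
pose i := Order.max (s ord_max) (t ord_max).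
have le (f : 'I_m.+1 -> I) u : incr f -> (f u <= f ord_max)%O.
  move=> fI; have := leq_ord u; rewrite leq_eqVlt => /predU1P[e|lt].
    by rewrite (_ : u = ord_max)//; apply: val_inj.
  by apply: ltW; apply: fI.
apply: (H i) => //; first by rewrite /i; case: leP => _.
- by move=> u; split=> //; rewrite le_max le.
- by move=> u; split=> //; rewrite le_max orbC le.
Qed.

Lemma indiscernible_ge W (D : set I) (c : W -> M) :
  (forall i, D i -> indiscernible_over [set j | D j /\ (i <= j)%O] a c) ->
  indiscernible_over D a c.
Proof.
move=> H [|m] s t sD tD sI tI.
  by congr tp; apply/funext => -[[]].
pose i := Order.min (s ord0) (t ord0).
have ge (f : 'I_m.+1 -> I) u : incr f -> (f ord0 <= f u)%O.
  move=> fI; have := leq0n u; rewrite leq_eqVlt => /predU1P[e|lt].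
    by rewrite (_ : u = ord0)//; apply: val_inj.
  by apply: ltW; apply: fI.
apply: (H i) => //; first by rewrite /i; case: leP => _.
- by move=> u; split=> //; rewrite ge_min ge.
- by move=> u; split=> //; rewrite ge_min orbC ge.
Qed.

Lemma indiscernible_sub1 W (D : set I) (c : W -> M) :
  (forall i j, D i -> D j -> i = j) -> indiscernible_over D a c.
Proof.
move=> H m s t sD tD _ _; congr tp; apply/funext => p.
by rewrite (H (s p.1) (t p.1)).
Qed.

Lemma indiscernible_over_tp W (D : set I) (c : W -> M) i j :
  indiscernible_over D a c -> D i -> D j -> tp (a i) c = tp (a j) c.
Proof.
move=> H Di Dj.
have := H 1 (fun=> i) (fun=> j) (fun=> Di) (fun=> Dj) _ _.
have none (f : 'I_1 -> I) (u v : 'I_1) : (u < v)%N -> (f u < f v)%O.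
  by rewrite (ord1 u) (ord1 v).
move=> /(_ (none _) (none _)) E.
pose g (s : 'I_k + W) : 'I_1 * 'I_k + W :=
  match s with inl u => inl (ord0, u) | inr w => inr w end.
have Eg l : join (a l) c = join (fun p : 'I_1 * 'I_k => a l p.2) c \o g.
  by apply/funext => -[].
apply/seteqP; split=> chi; rewrite /tp /= !Eg -!(sat_rename g);
by have := congr1 (fun S => S (rename g chi)) E; rewrite /tp /= => ->.
Qed.

End Indiscernible.

(** * Two separate failures of indiscernibility give finite patterns *)

Section TwoBreaks.
Variables (L : language) (M : structure L).
Variables (d : Order.disp_t) (I : orderType d) (k : nat) (a : I -> 'I_k -> M).
Variables (W : finType) (c : W -> M) (D : set I).
Hypotheses (D_inf : infinite_set D) (a_ind : indiscernible_over D a c).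

(** The formula theta read on the tuple of indices beta, with x at the place of
    the extra parameter. *)
Definition bit m (theta : formula L (('I_m * 'I_k) + (W + unit))) (x : M)
    (beta : 'I_m -> I) : Prop :=
  sat (join (fun p => a (beta p.1) p.2) (join c (fun=> x))) theta.

Variables (m1 m2 : nat).
Variables (theta1 : formula L (('I_m1 * 'I_k) + (W + unit))).
Variables (theta2 : formula L (('I_m2 * 'I_k) + (W + unit))).

(** That some element separates s1 from t1 through theta1 and s2 from t2 through
    theta2 is a property of the parameters at these indices, so it can be moved
    along the sequence.  The image is taken in a chain of six segments of length Z:
    s1 and t1 go to the second segment, s2 and t2 to the fifth, and the other four
    are the room around them.  The bounds have the form that [row_selection]
    expects, with bases 0 and Z * 3. *)
Lemma spread_breaks Z i0 j0 y (s1 t1 : 'I_m1 -> I) (s2 t2 : 'I_m2 -> I) :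
  (i0 < j0)%O -> (m1 + m1 + (m2 + m2) < Z)%N ->
  incr s1 -> incr t1 -> incr s2 -> incr t2 ->
  (forall u, D (s1 u) /\ (s1 u <= i0)%O) -> (forall u, D (t1 u) /\ (t1 u <= i0)%O) ->
  (forall u, D (s2 u) /\ (j0 <= s2 u)%O) -> (forall u, D (t2 u) /\ (j0 <= t2 u)%O) ->
  ~ (bit theta1 y s1 <-> bit theta1 y t1) ->
  ~ (bit theta2 y s2 <-> bit theta2 y t2) ->
  exists (e : nat -> I) (x : M) (s1' t1' : 'I_m1 -> nat) (s2' t2' : 'I_m2 -> nat),
    [/\ (forall p, (p < Z * 6)%N -> D (e p)) /\
        (forall p q, (p < q < Z * 6)%N -> (e p < e q)%O),
        [/\ incr s1', incr t1', incr s2' & incr t2'],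
        (forall u, 0 + Z <= s1' u < 0 + Z * 2)%N /\
        (forall u, 0 + Z <= t1' u < 0 + Z * 2)%N,
        (forall u, Z * 3 + Z <= s2' u < Z * 3 + Z * 2)%N /\
        (forall u, Z * 3 + Z <= t2' u < Z * 3 + Z * 2)%N &
        ~ (bit theta1 x (e \o s1') <-> bit theta1 x (e \o t1')) /\
        ~ (bit theta2 x (e \o s2') <-> bit theta2 x (e \o t2'))].
Proof.
move=> ij hZ s1I t1I s2I t2I s1D t1D s2D t2D sep1 sep2.
have [e [eD eI]] := infinite_chain (Z * 6) D_inf.
pose X := (('I_m1 + 'I_m1) + ('I_m2 + 'I_m2))%type.
pose H (q : X) := match q with
  | inl (inl u) => s1 u | inl (inr u) => t1 u
  | inr (inl u) => s2 u | inr (inr u) => t2 u end.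
have HD q : D (H q).
  by case: q => -[] u; [case: (s1D u)|case: (t1D u)|case: (s2D u)|case: (t2D u)].
pose F := codom H.
(* Within a segment, the order is preserved by counting smaller indices. *)
pose pos i := if (i <= i0)%O then (Z + rank F i)%N else (Z * 4 + rank F i)%N.
have rankZ i : (rank F i < Z)%N.
  apply: leq_ltn_trans hZ; apply: leq_trans (count_size _ _) _.
  by rewrite size_codom !card_sum !card_ord.
have posZ i : (pos i < Z * 6)%N.
  by rewrite /pos; have := rankZ i; case: ifP => _; lia.
have pos_mono q q' : (H q < H q')%O -> (pos (H q) < pos (H q'))%N.
  move=> lt; have r := rank_lt (codom_f H q) lt.
  rewrite /pos; have := rankZ (H q).
  case: (leP (H q) i0) => h; case: (leP (H q') i0) => h'.
  - by rewrite -/F in r *; lia.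
  - lia.
  - by have := lt_trans h (lt_le_trans lt h'); rewrite ltxx.
  - by rewrite -/F in r *; lia.
(* theta read at the indices s, with its last variable left to a quantifier. *)
pose put m (theta : formula L (('I_m * 'I_k) + (W + unit))) (s : 'I_m -> X) :=
  rename (fun q : ('I_m * 'I_k) + (W + unit) => match q with
    | inl p => Some (inl (s p.1, p.2)) | inr (inl w) => Some (inr w)
    | inr (inr _) => None end) theta : formula L (option ((X * 'I_k) + W)).
have sat_put m theta (s : 'I_m -> X) x (H' : X -> I) :
    sat (fun o => if o is Some z then join (fun p => a (H' p.1) p.2) c z else x)
      (put m theta s) <-> bit theta x (H' \o s).
  rewrite sat_rename /bit.
  rewrite (_ : _ \o _ = join (fun p => a ((H' \o s) p.1) p.2) (join c (fun=> x)))//.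
  by apply/funext => -[|[]].
pose Th := Ex (Conj
  [:: Xor (put _ theta1 (fun u => inl (inl u))) (put _ theta1 (fun u => inl (inr u)));
      Xor (put _ theta2 (fun u => inr (inl u))) (put _ theta2 (fun u => inr (inr u)))]).
have Th_y : sat (join (fun p => a (H p.1) p.2) c) Th.
  apply/sat_Ex; exists y; rewrite !sat_Conj_cons !sat_Xor !sat_put.
  by split=> //; split=> // -[].
have gD q : D ((e \o pos) (H q)) by apply: eD.
have gI q q' : (H q < H q')%O -> ((e \o pos) (H q) < (e \o pos) (H q'))%O.
  by move=> lt; apply: eI; rewrite pos_mono//=.
have : sat (join (fun p => a (((e \o pos) \o H) p.1) p.2) c) Th.
  exact: (iffLR (indiscernible_mono _ a_ind HD gD gI) Th_y).
move=> /sat_Ex[x]; rewrite !sat_Conj_cons !sat_Xor !sat_put => -[sep1' [sep2' _]].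
have lo i : (i <= i0)%O -> (0 + Z <= pos i < 0 + Z * 2)%N.
  by move=> le; rewrite /pos le; have := rankZ i; lia.
have hi i : (j0 <= i)%O -> (Z * 3 + Z <= pos i < Z * 3 + Z * 2)%N.
  move=> le; rewrite /pos leNgt (lt_le_trans ij le) /=.
  by have := rankZ i; lia.
exists e, x, (pos \o s1), (pos \o t1), (pos \o s2), (pos \o t2); split=> //.
- split=> u v uv.
  + exact: (pos_mono (inl (inl u)) (inl (inl v)) (s1I u v uv)).
  + exact: (pos_mono (inl (inr u)) (inl (inr v)) (t1I u v uv)).
  + exact: (pos_mono (inr (inl u)) (inr (inl v)) (s2I u v uv)).
  + exact: (pos_mono (inr (inr u)) (inr (inr v)) (t2I u v uv)).
- by split=> u; apply: lo; [case: (s1D u)|case: (t1D u)].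
- by split=> u; apply: hi; [case: (s2D u)|case: (t2D u)].
Qed.

(** Each tuple of the pattern consists of two consecutive blocks of m1-tuples, of
    two consecutive blocks of m2-tuples, and of the base c.  The booleans tell the
    first block of a pair from the second one. *)
Definition pattern_vars : finType :=
  (((bool * 'I_m1 * 'I_k) + (bool * 'I_m2 * 'I_k)) + W)%type.

Definition in_block1 (b : bool) (q : ('I_m1 * 'I_k) + (W + unit)) :
    unit + pattern_vars :=
  match q with
  | inl p => inr (inl (inl (b, p.1, p.2)))
  | inr (inl w) => inr (inr w) | inr (inr _) => inl tt end.
Definition in_block2 (b : bool) (q : ('I_m2 * 'I_k) + (W + unit)) :
    unit + pattern_vars :=
  match q with
  | inl p => inr (inl (inr (b, p.1, p.2)))
  | inr (inl w) => inr (inr w) | inr (inr _) => inl tt end.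

Definition change (r : bool) : formula L (unit + pattern_vars) :=
  if r then Xor (rename (in_block1 false) theta1) (rename (in_block1 true) theta1)
  else Xor (rename (in_block2 false) theta2) (rename (in_block2 true) theta2).

(** The indices below N * 2 * m1 are cut into the N * 2 blocks of the first row and
    the following N * 2 * m2 indices into the blocks of the second row. *)
Definition rows N (h : nat -> I) (l : nat) (y : pattern_vars) : M :=
  match y with
  | inl (inl p) => a (h ((l * 2 + p.1.1) * m1 + p.1.2)%N) p.2
  | inl (inr p) => a (h (N * 2 * m1 + ((l * 2 + p.1.1) * m2 + p.1.2))%N) p.2
  | inr w => c w end.

(** The existence of x is a property of the parameters at the indices h, so by
    indiscernibility it holds for all increasing choices of indices or for none.
    This lets one sequence of parameters serve all the paths eta. *)
Lemma rows_transfer N (h h' : nat -> I) (eta : bool -> nat) :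
  let B := (N * 2 * m1 + N * 2 * m2)%N in
  (forall p, (p < B)%N -> D (h p)) -> (forall p, (p < B)%N -> D (h' p)) ->
  (forall p q, (p < q < B)%N -> (h p < h q)%O) ->
  (forall p q, (p < q < B)%N -> (h' p < h' q)%O) ->
  (exists x, picks change (rows N h) `I_N eta x) ->
  exists x, picks change (rows N h') `I_N eta x.
Proof.
move=> B hD hD' hI hI'.
have [psi Hpsi] := picks_formula change N eta.
rewrite -!Hpsi.
have lt1 (l : 'I_N) (b : bool) (u : 'I_m1) : ((l * 2 + b) * m1 + u < B)%N.
  by have := ltn_ord l; have := ltn_ord u; case: b; rewrite /B /=; nia.
have lt2 (l : 'I_N) (b : bool) (u : 'I_m2) :
    (N * 2 * m1 + ((l * 2 + b) * m2 + u) < B)%N.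
  by have := ltn_ord l; have := ltn_ord u; case: b; rewrite /B /=; nia.
pose g (ly : 'I_N * pattern_vars) : 'I_B * 'I_k + W :=
  match ly.2 with
  | inl (inl p) => inl (Ordinal (lt1 ly.1 p.1.1 p.1.2), p.2)
  | inl (inr p) => inl (Ordinal (lt2 ly.1 p.1.1 p.1.2), p.2)
  | inr w => inr w end.
have E (f : nat -> I) : (fun ly : 'I_N * pattern_vars => rows N f ly.1 ly.2) =
    join (fun p : 'I_B * 'I_k => a (f p.1) p.2) c \o g.
  by apply/funext => -[l [[]|]].
rewrite !E -!(sat_rename g).
have := @a_ind B (h \o val) (h' \o val).
move=> /(_ (fun u => hD u (ltn_ord u)) (fun u => hD' u (ltn_ord u))) tpE.
have {}tpE := tpE (fun u v uv => hI u v (introT andP (conj uv (ltn_ord v))))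
  (fun u v uv => hI' u v (introT andP (conj uv (ltn_ord v)))).
by have := congr1 (fun S => S (rename g psi)) tpE; rewrite /tp /= => ->.
Qed.

(** [row_selection] is used once in each row, with the same x for both: the rows
    use disjoint parts of the chain. *)
Lemma breaks_finite_pattern i0 j0 y (s1 t1 : 'I_m1 -> I) (s2 t2 : 'I_m2 -> I) N :
  (i0 < j0)%O ->
  incr s1 -> incr t1 -> incr s2 -> incr t2 ->
  (forall u, D (s1 u) /\ (s1 u <= i0)%O) -> (forall u, D (t1 u) /\ (t1 u <= i0)%O) ->
  (forall u, D (s2 u) /\ (j0 <= s2 u)%O) -> (forall u, D (t2 u) /\ (j0 <= t2 u)%O) ->
  ~ (bit theta1 y s1 <-> bit theta1 y t1) ->
  ~ (bit theta2 y s2 <-> bit theta2 y t2) ->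
  exists b : nat -> pattern_vars -> M, finite_pattern change b N.
Proof.
move=> ij s1I t1I s2I t2I s1D t1D s2D t2D sep1 sep2.
pose Z := (N * 4 * m1 + N * 4 * m2 + (m1 + m1 + (m2 + m2))).+1.
have hZ : (m1 + m1 + (m2 + m2) < Z)%N by rewrite /Z; lia.
have [e [x [s1' [t1' [s2' [t2'
    [[eD eI] [s1I' t1I' s2I' t2I'] [s1Z t1Z] [s2Z t2Z] [sep1' sep2']]]]]]]] :=
  spread_breaks ij hZ s1I t1I s2I t2I s1D t1D s2D t2D sep1 sep2.
pose B := (N * 2 * m1 + N * 2 * m2)%N.
have paths i j : (i < N)%N -> (j < N)%N -> exists h : nat -> I,
    [/\ forall p, (p < B)%N -> D (h p),
        forall p q, (p < q < B)%N -> (h p < h q)%O &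
        picks change (rows N h) `I_N (fun r => if r then i else j) (fun=> x)].
  move=> iN jN.
  have Z1 : (N * 4 * m1 <= Z)%N by rewrite /Z; lia.
  have Z2 : (N * 4 * m2 <= Z)%N by rewrite /Z; lia.
  have [b1 [b1Z b1I b1bit]] := row_selection (bit := fun s => bit theta1 x (e \o s))
    Z1 iN s1I' t1I' s1Z t1Z sep1'.
  have [b2 [b2Z b2I b2bit]] := row_selection (bit := fun s => bit theta2 x (e \o s))
    Z2 jN s2I' t2I' s2Z t2Z sep2'.
  pose f p := if (p < N * 2 * m1)%N then b1 p else b2 (p - N * 2 * m1)%N.
  have fZ p : (p < B)%N -> (f p < Z * 6)%N.
    rewrite /f /B => pB; case: (ltnP p (N * 2 * m1)) => h; first by have := b1Z p h; lia.
    by have := b2Z (p - N * 2 * m1)%N; lia.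
  have fI p q : (p < q < B)%N -> (f p < f q)%N.
    move=> /andP[pq qB]; rewrite /f /B in qB *.
    case: (ltnP p (N * 2 * m1)) => hp; case: (ltnP q (N * 2 * m1)) => hq.
    - by apply: b1I; rewrite pq.
    - have := b1Z p hp; have := b2Z (q - N * 2 * m1)%N; lia.
    - lia.
    - by apply: b2I; lia.
  exists (e \o f); split=> [p pB|p q pq|r l lN].
  - by apply: eD; apply: fZ.
  - by apply: eI; rewrite fI// fZ//; case/andP: pq.
  case: r; rewrite /change sat_Xor !sat_rename.
    rewrite -b1bit// /bit.
    have E b : join (fun=> x) (rows N (e \o f) l) \o in_block1 b =
      join (fun p => a ((e \o @block m1 b1 (l * 2 + b)) p.1) p.2) (join c (fun=> x)).
      apply/funext => -[[u v]|[|]]//=; rewrite /f ifT//.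
      by have := ltn_ord u; simpl in lN; case: b; rewrite /=; nia.
    by rewrite !E addn0 addn1.
  rewrite -b2bit// /bit.
  have E b : join (fun=> x) (rows N (e \o f) l) \o in_block2 b =
    join (fun p => a ((e \o @block m2 b2 (l * 2 + b)) p.1) p.2) (join c (fun=> x)).
    apply/funext => -[[u v]|[|]]//=; rewrite /f ifF; last by apply/negbTE; lia.
    by rewrite addKn.
  by rewrite !E addn0 addn1.
have [->|N0] := posnP N.
  by exists (fun _ _ => x) => eta /(_ true).
have [h0 [h0D h0I _]] := paths 0 0 N0 N0.
exists (rows N h0) => eta etaN.
have [h [hD hI hx]] := paths (eta true) (eta false) (etaN _) (etaN _).
apply: (rows_transfer hD h0D hI h0I); exists (fun=> x) => r l lN.
by rewrite hx//; case: r.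
Qed.

End TwoBreaks.

(** * Pieces of an indiscernible sequence *)

Section Pieces.
Variables (L : language) (T : theory L) (M : structure L).
Hypothesis M_monster : monster T M.
Hypothesis T_dp : dp_minimal T.

(** Two failures on both sides of the gap between i0 and j0 would give finite
    patterns of every size, hence an ICT pattern by compactness. *)
Lemma no_two_breaks d (I : orderType d) k (a : I -> 'I_k -> M) (W : finType)
    (c : W -> M) (D : set I) (y : M) i0 j0 :
  infinite_set D -> indiscernible_over D a c -> (i0 < j0)%O ->
  indiscernible_over [set j | D j /\ (j <= i0)%O] a (join c (fun _ : unit => y)) \/
  indiscernible_over [set j | D j /\ (j0 <= j)%O] a (join c (fun _ : unit => y)).
Proof.
move=> Dinf aD ij; apply: contrapT => /not_orP[].
move=> /not_indiscernible[m1 [s1 [t1 [theta1 [s1D t1D s1I t1I sep1]]]]].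
move=> /not_indiscernible[m2 [s2 [t2 [theta2 [s2D t2D s2I t2I sep2]]]]].
have [|b Hb] := compact_pattern M_monster (phi := change theta1 theta2).
  move=> N; exact: (breaks_finite_pattern Dinf aD N ij
    s1I t1I s2I t2I s1D t1D s2D t2D sep1 sep2).
by have [TM _] := M_monster; apply: (infinite_pattern_ICT TM T_dp Hb).
Qed.

(** The pieces of D are the fibers of q; unlike those of a [convex_partition], they
    may be empty. *)
Definition pieces d (I : orderType d) k (a : I -> 'I_k -> M) W (c : W -> M)
    (D : set I) (N : nat) (X : finType) (q : I -> X) :=
  [/\ forall x, convex (D `&` [set i | q i = x]),
      forall x, indiscernible_over (D `&` [set i | q i = x]) a c &
      (#|[pred x | `[< infinite_set (D `&` [set i | q i = x]) >]]| <= N)%N].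

(** A finite D is cut into points.  An infinite D is the union of the initial
    segment [Lo], of the rest of the final segment [Hi], and of the indices in
    neither of them, of which there is at most one by [no_two_breaks]. *)
Lemma one_element_pieces d (I : orderType d) k (a : I -> 'I_k -> M) (W : finType)
    (c : W -> M) (D : set I) (y : M) :
  convex D -> indiscernible_over D a c ->
  exists m (q : I -> 'I_m.+1), pieces a (join c (fun _ : unit => y)) D
    (if `[< infinite_set D >] then 2 else 0) q.
Proof.
move=> Dconv aD.
case: asboolP => [Dinf|/contrapT Dfin]; last first.
  have [m [q qinj]] := finite_code Dfin.
  have q1 x i j : (D `&` [set i | q i = x]) i -> (D `&` [set i | q i = x]) j -> i = j.
    by move=> [Di <-] [Dj /esym]; apply: qinj; exact: mem_set.
  exists m, q; split=> [x i j l ix lx /andP[ij jl]|x|].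
  - move: jl; rewrite -(q1 x i l ix lx) => ji.
    by rewrite (_ : j = i)//; apply/le_anti; rewrite ji ij.
  - exact: indiscernible_sub1 (q1 x).
  - rewrite leqn0; apply/eqP/eq_card0 => x; rewrite !inE; apply/asboolP; apply.
    by apply: sub_finite_set Dfin => i [].
set c' := join c _.
pose Lo i := indiscernible_over [set j | D j /\ (j <= i)%O] a c'.
pose Hi i := indiscernible_over [set j | D j /\ (i <= j)%O] a c'.
have Lo_le i j : (i <= j)%O -> Lo j -> Lo i.
  move=> ij; apply: indiscernible_over_sub => l [Dl li].
  by split=> //; apply: le_trans ij.
have Hi_ge i j : (i <= j)%O -> Hi i -> Hi j.
  move=> ij; apply: indiscernible_over_sub => l [Dl li].
  by split=> //; apply: le_trans li.
have mid i j : ~ Lo i -> ~ Hi i -> ~ Lo j -> ~ Hi j -> i = j.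
  move=> Li Hi' Lj Hj; have [ij|ji|//] := ltgtP i j.
    by have [] := no_two_breaks y Dinf aD ij.
  by have [] := no_two_breaks y Dinf aD ji.
pose o n (lt3 : (n < 3)%N) : 'I_3 := Ordinal lt3.
pose q i := if `[< Lo i >] then @o 0 isT else if `[< Hi i >] then @o 2 isT else @o 1 isT.
have q0 i : q i = @o 0 isT <-> Lo i.
  by rewrite /q; case: asboolP => h //; case: asboolP.
have q2 i : q i = @o 2 isT <-> ~ Lo i /\ Hi i.
  by rewrite /q; case: asboolP => h; [split=> // -[]|case: asboolP => h'; split=> // -[]].
have q1 i : q i = @o 1 isT <-> ~ Lo i /\ ~ Hi i.
  by rewrite /q; case: asboolP => h; [split=> // -[]|case: asboolP => h'; split=> // -[]].
have oP (x : 'I_3) : [\/ x = @o 0 isT, x = @o 2 isT | x = @o 1 isT].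
  case: x => [[|[|[|//]]] x3]; [constructor 1|constructor 3|constructor 2];
  exact: val_inj.
exists 2, q; split=> [x|x|].
- move=> i j l [Di qi] [Dl ql] ijl; split; first exact: Dconv Di Dl ijl.
  move: ijl qi ql => /andP[ij jl]; case: (oP x) => ->; rewrite /= ?q0 ?q1 ?q2.
  + by move=> _; apply: Lo_le.
  + move=> [nLi Hi'] _; split; last exact: Hi_ge Hi'.
    by move=> Lj; apply: nLi; apply: Lo_le Lj.
  + move=> [nLi nHi] [nLl nHl]; have il := mid i l nLi nHi nLl nHl.
    by rewrite (_ : j = i)//; apply/le_anti; rewrite ij il jl.
- case: (oP x) => ->.
  + apply: indiscernible_le => i [Di /q0 Li]; apply: indiscernible_over_sub Li.
    by move=> j [[Dj _] ji].
  + apply: indiscernible_ge => i [Di /q2[_ Li]]; apply: indiscernible_over_sub Li.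
    by move=> j [[Dj _] ji].
  + apply: indiscernible_sub1 => i j [Di /q1[? ?]] [Dj /q1[? ?]]; exact: mid.
- apply: (@leq_trans #|predC1 (@o 1 isT)|); last by rewrite cardC1 card_ord.
  apply: subset_leq_card; apply/fintype.subsetP => x.
  rewrite !unfold_in /= => /asboolP inf.
  apply/eqP => x1; apply: inf; rewrite x1.
  have [[i [_ /q1 qi]]|no] := pselect ((D `&` [set i | q i = @o 1 isT]) !=set0).
    apply: sub_finite_set (finite_set1 i) => j [_ /q1 qj] /=.
    exact: mid qj.1 qj.2 qi.1 qi.2.
  by apply: contrapT => /infinite_setN0.
Qed.

(** Each entry of c is added to the base by [one_element_pieces], applied in every
    piece obtained so far; this at most doubles the number of infinite pieces. *)
Lemma pieces_exist d (I : orderType d) k (a : I -> 'I_k -> M) n (c : 'I_n -> M) :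
  indiscernible a ->
  exists (X : finType) (q : I -> X), pieces a c setT (2 ^ n) q.
Proof.
move=> a_ind; elim: n c => [|n IH] c.
  exists unit, (fun=> tt); split=> [[]|[]|] //.
    pose g (i : 'I_0) : void := False_rect _ (notF (ltn_ord i)).
    rewrite (_ : c = of_void M \o g); last by apply/funext => -[].
    by apply: indiscernible_over_comp; apply: indiscernible_over_sub a_ind.
  by rewrite (leq_trans (max_card _))// card_unit.
have [X [q [qconv qind qcard]]] := IH (fun i => c (widen_ord (leqnSn n) i)).
have /choice[m Hm] (x : X) := one_element_pieces (c ord_max) (qconv x) (qind x).
pose p x := sval (cid (Hm x)).
have Hp x := svalP (cid (Hm x)); rewrite -/(p _) in Hp.
pose X' : finType := {x : X & 'I_(m x).+1}.
pose q' i : X' := Tagged _ (p (q i) i).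
have fiber x z : setT `&` [set i | q' i = Tagged _ z] =
    (setT `&` [set i | q i = x]) `&` [set i | p x i = z].
  rewrite !setTI; apply/seteqP; split=> i /=.
    move=> e; have qx : q i = x := congr1 (@tag _ _) e.
    case: _ / qx in z e *; split=> //.
    by move/eqP: e; rewrite eq_Tagged /= => /eqP.
  by move=> [qx <-]; rewrite /q' qx.
exists X', q'; split=> [[x z]|[x z]|].
- by rewrite fiber; have [h _ _] := Hp x.
- rewrite fiber; have [_ h _] := Hp x.
  pose g (i : 'I_n.+1) : 'I_n + unit :=
    if unlift ord_max i is Some j then inl j else inr tt.
  rewrite (_ : c = join (fun i => c (widen_ord (leqnSn n) i)) (fun=> c ord_max) \o g).
    exact: indiscernible_over_comp (h z).
  apply/funext => i; rewrite /g /=; case: unliftP => [j ->|->] //=.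
  by congr c; apply/val_inj/lift_max.
- pose inf x : pred 'I_(m x).+1 := fun z =>
    `[< infinite_set (setT `&` [set i | q' i = Tagged (fun x => 'I_(m x).+1) z]) >].
  have -> : #|[pred u | `[< infinite_set (setT `&` [set i | q' i = u]) >]]| =
      \sum_x \sum_(z | inf x z) 1.
    rewrite -sum1_card (sig_big_dep xpredT inf (fun _ _ => 1)).
    by apply: eq_bigl => -[x z]; rewrite unfold_in.
  have le x : \sum_(z | inf x z) 1 <=
      if `[< infinite_set (setT `&` [set i | q i = x]) >] then 2 else 0.
    have [_ _ h] := Hp x; apply: leq_trans h.
    rewrite -sum1_card leq_eqVlt; apply/orP; left; apply/eqP; apply: eq_bigl => z.
    by rewrite unfold_in /= /inf fiber.
  apply: leq_trans (leq_sum _ (fun x _ => le x)) _.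
  rewrite -big_mkcond /= sum_nat_const mulnC expnS leq_mul2l /=.
  apply: leq_trans qcard; apply: subset_leq_card; apply/fintype.subsetP => x.
  by rewrite !unfold_in.
Qed.

(** Only the nonempty fibers are kept. *)
Lemma pieces_partition d (I : orderType d) k (a : I -> 'I_k -> M) W (c : W -> M)
    N (X : finType) (q : I -> X) :
  pieces a c setT N q ->
  exists m (P : 'I_m -> set I),
    convex_partition N P /\ forall l, indiscernible_over (P l) a c.
Proof.
move=> [qconv qind qcard].
pose S := [pred x : X | `[< exists i, q i = x >]].
exists #|S|, (fun l => setT `&` [set i | q i = enum_val l]); split; last by move=> l.
split; last 1 first.
- apply: leq_trans qcard; rewrite -(fintype.card_image (@enum_val_inj _ S)).
  apply: subset_leq_card; apply/fintype.subsetP => x /fintype.imageP[l + ->].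
  by rewrite !unfold_in.
- split.
  + apply/seteqP; split=> // i _.
    have qS : q i \in S by rewrite unfold_in /=; apply/asboolP; exists i.
    by exists (enum_rank_in qS (q i)) => //; split=> //=; rewrite enum_rankK_in.
  + by move=> l l' _ _ [i [[_ /= e] [_ /= e']]]; apply: enum_val_inj; rewrite -e.
  + move=> l _; have := enum_valP l; rewrite unfold_in /= => /asboolP[i e].
    by exists i.
- by move=> l.
Qed.

End Pieces.

(** * The equivalence *)

Theorem fact2p10 (L : language) (T : theory L) (M : structure L)
    (T_complete : complete T) (M_monster : monster T M) :
  [<->
    dp_minimal T;

    forall n : nat, (1 <= n)%N ->
    forall (d : Order.disp_t) (I : orderType d) (k : nat)
      (a : I -> 'I_k -> M) (c : 'I_n -> M),
      indiscernible a ->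
      exists (m : nat) (P : 'I_m -> set I),
        convex_partition (2 ^ n) P /\
        forall (l : 'I_m) (i j : I), P l i -> P l j -> tp (a i) c = tp (a j) c;

    forall n : nat, (1 <= n)%N ->
    forall (d : Order.disp_t) (I : orderType d) (k : nat)
      (a : I -> 'I_k -> M) (c : 'I_n -> M),
      indiscernible a ->
      exists (m : nat) (P : 'I_m -> set I),
        convex_partition (2 ^ n) P /\
        forall l : 'I_m, indiscernible_over (P l) a c;

    forall n : nat, (1 <= n)%N ->
    ~ exists (k : nat) (phi : 'I_(2 ^ n) -> formula L ('I_n + 'I_k))
        (a : 'I_(2 ^ n) -> nat -> 'I_k -> M),
        forall eta : 'I_(2 ^ n) -> nat,
          consistent
            ([set inst (phi j) (a j (eta j)) | j in [set: 'I_(2 ^ n)]]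
             `|` [set f | exists (j : 'I_(2 ^ n)) (t : nat),
                    t <> eta j /\ f = Neg (inst (phi j) (a j t))])%classic
  ].
Proof.
have one_three : dp_minimal T -> forall n d (I : orderType d) k
    (a : I -> 'I_k -> M) (c : 'I_n -> M), indiscernible a ->
    exists m (P : 'I_m -> set I),
      convex_partition (2 ^ n) P /\ forall l, indiscernible_over (P l) a c.
  move=> T_dp n d I k a c /(pieces_exist M_monster T_dp c)[X [q Hq]].
  exact: pieces_partition Hq.
have three_two n d (I : orderType d) k (a : I -> 'I_k -> M) (c : 'I_n -> M) :
   (exists m (P : 'I_m -> set I),
      convex_partition (2 ^ n) P /\ forall l, indiscernible_over (P l) a c) ->
   exists m (P : 'I_m -> set I), convex_partition (2 ^ n) P /\
    forall (l : 'I_m) (i j : I), P l i -> P l j -> tp (a i) c = tp (a j) c.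
  move=> [m [P [HP Hind]]]; exists m, P; split=> // l i j Pi Pj.
  exact: indiscernible_over_tp (Hind l) Pi Pj.
have two_four (n : nat) := constant_types_no_long_pattern M_monster (n := n).
have four_one := no_long_pattern_dp_minimal T_complete M_monster.
tfae.
- by move=> T_dp n n1 d I k a c a_ind; apply: three_two; apply: one_three.
- move=> H2 n n1 d I k a c; apply: one_three; apply: four_one; apply: two_four.
  exact: H2.
- by move=> H3 n n1; apply: two_four => d I k a c a_ind; apply: three_two; apply: H3.
- by move=> H4; apply: four_one; apply: H4.
Qed.
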